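(* Let $\alpha$ be a Riemannian metric and $\beta$ a 1-form on a manifold $M$, let $V$ be a vector field on $M$ and $c$ a scalar function on $M$. (1) If $F=\beta^m\alpha^{1-m}$ ($m\neq 0,1$ a constant) is an $m$-Kropina metric with $\|\beta\|_\alpha=1$, then $V$ is a conformal vector field of $F$ with conformal factor $c$ if and only if $$V^c(\alpha^2)=4c\,\alpha^2\quad\text{and}\quad V^c(\beta)=2c\,\beta.$$ (2) If $F=\beta e^{\pm\alpha^2/\beta^2}$ (with either fixed choice of sign), then $V$ is a conformal vector field of $F$ with conformal factor $c$ if and only if there is a scalar function $\tau$ on $M$ such that $$V^c(\alpha^2)=2\tau\,\alpha^2\pm(2c-\tau)\,\beta^2\quad\text{and}\quad V^c(\beta)=\tau\,\beta,$$ where the sign $\pm$ is the same as the one in $F$.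
   Context: Here $\alpha=\sqrt{a_{ij}(x)y^iy^j}$ is positive definite, $\beta=b_i(x)y^i$, and $\|\beta\|_\alpha=\sqrt{a^{ij}b_ib_j}$. The metrics $F=\beta^m\alpha^{1-m}$ and $F=\beta e^{\pm\alpha^2/\beta^2}$ are singular Finsler metrics (of the form $F=\alpha\phi(\beta/\alpha)$), considered on the open conic part of $TM\setminus0$ where they are defined and positive (e.g. $\beta>0$). Complete lift: for a vector field $V=V^i\partial/\partial x^i$ on $M$, $V^c:=V^i\frac{\partial}{\partial x^i}+y^i\frac{\partial V^j}{\partial x^i}\frac{\partial}{\partial y^j}$ is the complete lift of $V$ to $TM$ (the superscript $c$ is only notation, unrelated to the function $c$). Functions such as $\alpha^2$ and $\beta$ are regarded as functions on $TM$. Conformal vector field: let $\varphi_t$ be the flow of $V$ and $\widetilde\varphi_t(x,y)=(\varphi_t(x),\varphi_{t*}(y))$. $V$ is conformal for $F$ if $\widetilde\varphi_t^*F=e^{2\sigma_t}F$ with $\sigma_t$ a function on $M$ for every $t$; its conformal factor is $c=\frac{d}{dt}\big|_{t=0}\sigma_t$. Equivalently, $V$ is conformal with conformal factor $c=c(x)$ iff $V^c(F)=2cF$. *)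

(* Defs.v *)
From HB Require Import structures.
From mathcomp Require Import all_boot all_order all_algebra.
From mathcomp Require Import all_classical all_reals all_analysis.

Set Implicit Arguments.
Unset Strict Implicit.
Unset Printing Implicit Defensive.

Import Order.TTheory GRing.Theory Num.Theory.
Import numFieldNormedType.Exports.

Local Open Scope classical_set_scope.
Local Open Scope ring_scope.

Section Smooth.
Context {R : realType} {E F : normedModType R}.

(* [U] is meant to be open: ['D_v f] at a point depends on [f] nearby. *)
Fixpoint Ck_on (k : nat) (U : set E) (f : E -> F) : Prop :=
  match k with
  | 0 => forall x, U x -> {for x, continuous f}
  | k'.+1 => (forall x, U x -> differentiable f x) /\
             (forall v : E, Ck_on k' U (fun x => 'D_v f x))
  end.

Definition smooth_on (U : set E) (f : E -> F) : Prop :=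
  forall k, Ck_on k U f.

End Smooth.

(* Smooth manifolds of dimension [n], given by an atlas. The maps [chart i] and
   [chinv i] are total, but only meaningful on [chdom i], resp. its image. *)
Record manifold (R : realType) (n : nat) := Manifold {
  point :> topologicalType;
  point_hausdorff : hausdorff_space point;
  point_second_countable : @second_countable point;
  chidx : Type;
  chdom : chidx -> set point;
  chart : chidx -> point -> 'rV[R]_n;
  chinv : chidx -> 'rV[R]_n -> point;
  chdom_open : forall i, open (chdom i);
  chdom_cover : forall p, exists i, chdom i p;
  chimg_open : forall i, open (chart i @` chdom i);
  chartK : forall i p, chdom i p -> chinv i (chart i p) = p;
  chart_continuous : forall i p, chdom i p -> {for p, continuous (chart i)};
  chinv_continuous : forall i u, (chart i @` chdom i) u ->
    {for u, continuous (chinv i)};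
  chart_compatible : forall i j,
    smooth_on (chart i @` (chdom i `&` chdom j)) (chart j \o chinv i)
}.

Arguments chidx {R n} m.
Arguments chdom {R n m}.
Arguments chart {R n m}.
Arguments chinv {R n m}.

Section Geometry.
Context {R : realType} {n : nat}.

Definition chimg (M : manifold R n) (i : chidx M) : set 'rV[R]_n :=
  chart i @` chdom i.

(* A tensor field is given by its components in every chart [i], at every point
   [p] of [chdom i], subject to the transformation law between charts.
   [tchange i j p y] are the components in chart [j] of the tangent vector at
   [p] whose components in chart [i] are [y]. *)
Definition tchange (M : manifold R n) (i j : chidx M) (p : M)
    (y : 'rV[R]_n) : 'rV[R]_n :=
  'D_y (chart j \o chinv i) (chart i p).

Definition smooth_fun (M : manifold R n) (f : M -> R) : Prop :=
  forall i : chidx M, smooth_on (chimg i) (f \o chinv i).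

Record vector_field (M : manifold R n) := VectorField {
  vcomp :> chidx M -> M -> 'rV[R]_n;
  vcomp_smooth : forall i, smooth_on (chimg i) (vcomp i \o chinv i);
  vcomp_change : forall i j p, chdom i p -> chdom j p ->
    vcomp j p = tchange i j p (vcomp i p)
}.

Record one_form (M : manifold R n) := OneForm {
  bcomp :> chidx M -> M -> 'rV[R]_n;
  bcomp_smooth : forall i, smooth_on (chimg i) (bcomp i \o chinv i);
  bcomp_change : forall i j p y, chdom i p -> chdom j p ->
    \sum_k bcomp j p 0 k * tchange i j p y 0 k = \sum_k bcomp i p 0 k * y 0 k
}.

Record riemannian_metric (M : manifold R n) := RiemannianMetric {
  acomp :> chidx M -> M -> 'M[R]_n;
  acomp_smooth : forall i, smooth_on (chimg i) (acomp i \o chinv i);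
  acomp_change : forall i j p y, chdom i p -> chdom j p ->
    \sum_k \sum_l
      acomp j p k l * tchange i j p y 0 k * tchange i j p y 0 l =
    \sum_k \sum_l acomp i p k l * y 0 k * y 0 l;
  acomp_sym : forall i p, chdom i p -> (acomp i p)^T = acomp i p;
  acomp_pos : forall i p (y : 'rV[R]_n), chdom i p -> y != 0 ->
    0 < \sum_k \sum_l acomp i p k l * y 0 k * y 0 l
}.

(* Functions on TM (or on part of it): [f i p y] is the value at the tangent
   vector at [p] with components [y] in the chart [i]. *)
Definition tmfun (M : manifold R n) := chidx M -> M -> 'rV[R]_n -> R.

Section Metrics.
Context {M : manifold R n} (a : riemannian_metric M) (b : one_form M).

Definition alpha2 : tmfun M :=
  fun i p y => \sum_k \sum_l a i p k l * y 0 k * y 0 l.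

Definition alpha : tmfun M := fun i p y => Num.sqrt (alpha2 i p y).

Definition beta : tmfun M := fun i p y => \sum_k b i p 0 k * y 0 k.

Definition norm_beta (i : chidx M) (p : M) : R :=
  Num.sqrt (\sum_k \sum_l invmx (a i p) k l * b i p 0 k * b i p 0 l).

(* The open conic part of TM on which the singular metrics are considered. *)
Definition beta_cone (i : chidx M) (p : M) : set 'rV[R]_n :=
  [set y | 0 < beta i p y].

Definition kropina (m : R) : tmfun M :=
  fun i p y => beta i p y `^ m * alpha i p y `^ (1 - m).

Definition exp_metric (e : R) : tmfun M :=
  fun i p y => beta i p y * expR (e * (alpha2 i p y / beta i p y ^+ 2)).

End Metrics.

Definition complete_lift (M : manifold R n) (V : vector_field M)
    (f : tmfun M) : tmfun M :=
  fun i p y =>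
    \sum_k V i p 0 k *
      'D_(delta_mx 0 k) (fun u => f i (chinv i u) y) (chart i p) +
    \sum_k \sum_l y 0 k *
      'D_(delta_mx 0 k) (fun u => V i (chinv i u) 0 l) (chart i p) *
      'D_(delta_mx 0 l) (f i p) y.

Definition integral_curve (M : manifold R n) (V : vector_field M)
    (J : set R) (g : R -> M) : Prop :=
  forall t, J t -> {for t, continuous g} /\
    forall j, chdom j (g t) ->
      is_derive t (1 : R) (fun s => chart j (g s)) (V j (g t)).

(* The (maximal, local) flow of [V]: [fmap t p] is the point reached at time [t]
   from [p], and is meaningful for [(t, p)] in [fdom]. *)
Record flow (M : manifold R n) (V : vector_field M) := Flow {
  fdom : set (R * M);
  fmap : R -> M -> M;
  fdom_open : open fdom;
  fdom_interval : forall p, is_interval [set t | fdom (t, p)];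
  fdom0 : forall p, fdom (0, p);
  fmap0 : forall p, fmap 0 p = p;
  fmap_continuous : forall z, fdom z ->
    {for z, continuous (fun w : R * M => fmap w.1 w.2)};
  fmap_smooth : forall i j : chidx M,
    smooth_on
      [set w : R * 'rV[R]_n | [/\ chimg i w.2, fdom (w.1, chinv i w.2) &
                                 chdom j (fmap w.1 (chinv i w.2))]]
      (fun w : R * 'rV[R]_n => chart j (fmap w.1 (chinv i w.2)));
  fmap_integral : forall p,
    integral_curve V [set t | fdom (t, p)] (fun t => fmap t p);
  fmap_maximal : forall (J : set R) (g : R -> M),
    open J -> is_interval J -> J 0 -> integral_curve V J g ->
    forall t, J t -> fdom (t, g 0)
}.

(* Components in chart [j] of the push-forward by the time-[t] map of the
   tangent vector at [p] with components [y] in chart [i]. *)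
Definition push (M : manifold R n) (V : vector_field M) (phi : flow V)
    (t : R) (i j : chidx M) (p : M) (y : 'rV[R]_n) : 'rV[R]_n :=
  'D_y (fun u => chart j (fmap phi t (chinv i u))) (chart i p).

(* [V], with flow [phi], is conformal with factor [c] for the function [F]
   defined on the part [C] of TM. The equality of partial functions
   [pullback F = exp (2 sigma_t) F] includes that of their domains. *)
Definition conformal (M : manifold R n) (V : vector_field M) (phi : flow V)
    (C : forall (i : chidx M) (p : M), set 'rV[R]_n) (F : tmfun M)
    (c : M -> R) : Prop :=
  exists sigma : R -> M -> R,
    (forall t p i j y, fdom phi (t, p) ->
       chdom i p -> chdom j (fmap phi t p) ->
       (C j (fmap phi t p) (push phi t i j p y) <-> C i p y) /\
       (C i p y ->
        F j (fmap phi t p) (push phi t i j p y) =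
          expR (2 * sigma t p) * F i p y)) /\
    (forall p, is_derive (0 : R) (1 : R) (fun t => sigma t p) (c p)).

End Geometry.

(* Main.v *)
Require Import Defs.
From mathcomp Require Import all_boot all_order all_algebra.
From mathcomp Require Import all_classical all_reals all_analysis.
From mathcomp Require Import ring lra.

Set Implicit Arguments.
Unset Strict Implicit.
Unset Printing Implicit Defensive.

Import Order.TTheory GRing.Theory Num.Theory.
Import numFieldNormedType.Exports.

Local Open Scope classical_set_scope.
Local Open Scope ring_scope.

(** The proof transports alpha^2 and beta along the flow of V.  For a tangent
    vector (p, y) write beta_t and alpha_t^2 for the values of beta and alpha^2
    at its image under the tangent map of the time-t flow.  The complete lift
    is the infinitesimal generator of this transport: for a function f on TM,
    d/dt f_t = (V^c f)_t at every time t of the flow domain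
    ([is_derive_push_tm]).  This rests on the variational equation
    ([is_derive_push]), which is the symmetry of second derivatives
    ([derive_swap]) applied to the flow read in charts.

    Both metrics have the form F = exp (L (beta, alpha^2)) with L explicit, so
    conformality says that L (beta_t, alpha_t^2) - 2 sigma_t is constant in t.

    From conformality to the equations, differentiating at t = 0 gives, with
    A = V^c (alpha^2), a quadratic form in y, and B = V^c beta, a linear form,
    a polynomial identity on the half-space beta > 0:

      alpha^2 (2 m B - 4 c beta) + (1 - m) A beta = 0         (m-Kropina),
      - 2 e alpha^2 B + (e A + B beta - 2 c beta^2) beta = 0  (exponential).

    Where beta vanishes alpha^2 does not, so the linear factor of alpha^2 must
    vanish there ([cone_kernel]) and is therefore a multiple of beta; hence
    B = tau beta.  In the exponential case what is left, after division by
    beta, is the formula for A, first on the half-space and then everywhere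
    ([quadratic_form_cone_eq0]).  In the m-Kropina case one gets
    A = mu alpha^2, where mu and tau are tied by one equation.  A second one
    comes from the norm of beta being 1: then beta^2 <= alpha^2 ([beta_sqr_le]),
    with equality at the vector w dual to beta, so alpha_t^2 (w) - beta_t (w)^2
    is minimal at t = 0, and its derivative mu - 2 tau vanishes there.  Together
    these force tau = 2 c and mu = 4 c.

    Conversely, the equations are linear differential equations for beta_t and
    alpha_t^2 along each orbit.  With primitives of c and tau along the orbit
    ([primitive_along]) they are solved explicitly by [linear_ode], and
    sigma_t is the primitive of c vanishing at t = 0. *)

(** * Derivatives along lines and curves *)

Section Calculus.
Context {R : realType}.

(** The chain rule for a curve followed by a map between normed spaces, with
    the outer derivative taken in the direction of the velocity. *)
Lemma is_derive_curve {E F : normedModType R} (f : E -> F) (g : R -> E)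
    (t : R) (dg : E) :
  is_derive t 1 g dg -> differentiable f (g t) ->
  is_derive t 1 (fun s => f (g s)) ('D_dg f (g t)).
Proof.
move=> [dg1 dgE] df.
have dg' : differentiable g t by apply/derivable1_diffP.
have dfg : differentiable (f \o g) t by exact: differentiable_comp.
apply: DeriveDef; first exact/derivable1_diffP.
rewrite deriveE // (deriveE _ df) -dgE (deriveE _ dg').
by rewrite diff_comp.
Qed.

Lemma is_derive_line {E : normedModType R} (x v : E) (t : R) :
  is_derive t 1 (fun s : R => x + s *: v) v.
Proof.
have dl : differentiable (fun s : R => s *: v) t by [].
apply: (@is_derive_eq _ _ _ _ _ _ _ (0 + v)); last by rewrite add0r.
apply: is_deriveD; apply: DeriveDef; first exact/derivable1_diffP.
by rewrite deriveE // diff_val /= scale1r.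
Qed.

(** The second difference of [g] over the parallelogram spanned by h v and h w
    approximates h^2 times the mixed derivative.  The mean value theorem in the
    direction v turns it into a first difference of 'D_v g, and
    differentiability of 'D_v g at the base point alone controls that. *)
Lemma second_difference {E : normedModType R} (g : E -> R) (x v w : E) (eps : R) :
  0 < eps -> (\forall z \near x, differentiable g z) ->
  differentiable ('D_v g) x ->
  exists2 d : R, 0 < d & forall h : R, 0 < h < d ->
    `|g (x + h *: v + h *: w) - g (x + h *: v) - g (x + h *: w) + g x -
      h ^+ 2 * 'D_w ('D_v g) x| <= eps * h ^+ 2.
Proof.
move=> e0 dg ddg.
(* N bounds the displacements s v + u w used below, with room to spare, and
   is positive even when v = w = 0. *)
pose N := `|v| + `|w| + 1.
have N0 : 0 < N by rewrite /N ltr_wpDl // addr_ge0.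
have e1 : 0 < eps / (2 * N) by rewrite divr_gt0 // mulr_gt0.
have [r1 /= r10 H1] : exists2 r : R, 0 < r & forall k, `|k| < r ->
    `|'D_v g (x + k) - 'D_v g x - 'd ('D_v g) x k| <= eps / (2 * N) * `|k|.
  have [r r0 H] := nbhs_norm0P.1 ((eqaddoP _ _ _ _).1 (diff_locally ddg) _ e1).
  by exists r => // k /H; rewrite !fctE /= opprD addrA (addrC k).
have [r2 /= r20 H2] := (nbhs_normP _ _).1 dg.
exists (Num.min r1 r2 / N).
  by rewrite divr_gt0 // lt_min r10.
move=> h /andP[h0]; rewrite ltr_pdivlMr // lt_min => /andP[hr1 hr2].
have bnd s : 0 <= s <= h -> forall u, 0 <= u <= h ->
    `|s *: v + u *: w| <= h * (N - 1).
  move=> /andP[s0 sh] u /andP[u0 uh].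
  rewrite (le_trans (ler_normD _ _))// !normrZ !ger0_norm //.
  rewrite /N addrK mulrDr lerD // ler_wpM2r //.
have hN : h * (N - 1) < h * N by rewrite ltr_pM2l // ltrBlDr ltrDl.
have dphi s : 0 <= s <= h -> forall u, 0 <= u <= h ->
    is_derive s 1 (fun s => g (x + u *: w + s *: v)) ('D_v g (x + (s *: v + u *: w))).
  move=> sh u uh.
  have xE : x + (s *: v + u *: w) = x + u *: w + s *: v.
    by rewrite addrCA addrC.
  rewrite xE; apply: is_derive_curve; first exact: is_derive_line.
  rewrite -xE; apply: H2; rewrite /ball_ /= opprD addNKr normrN.
  by rewrite (le_lt_trans (bnd _ sh _ uh)) // (lt_trans hN).
have z0h : 0 <= (0:R) <= h by rewrite lexx ltW.
have hh : 0 <= h <= h by rewrite lexx ltW.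
pose phi s := g (x + h *: w + s *: v) - g (x + 0 *: w + s *: v).
pose dp s := 'D_v g (x + (s *: v + h *: w)) - 'D_v g (x + (s *: v + 0 *: w)).
have dphi' s : 0 <= s <= h -> is_derive s 1 phi (dp s).
  by move=> sh; apply: is_deriveB; apply: dphi.
have cphi : {within `[0, h], continuous phi}.
  apply: derivable_within_continuous => s; rewrite in_itv /= => sh.
  by have [] := dphi' s sh.
have [th] := @MVT _ phi dp _ _ h0 (fun s sh => dphi' s
  (subset_itv_oo_cc sh)) cphi.
move=> /subset_itv_oo_cc; rewrite in_itv /= => thh.
rewrite /phi /dp !scale0r !addr0 subr0 => E1.
rewrite [_ - _ - _ + _](_ : _ = ('D_v g (x + (th *: v + h *: w)) -
  'D_v g (x + th *: v)) * h); last first.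
  by rewrite -E1 (addrAC x (h *: w)); ring.
have A1 := H1 (th *: v + h *: w) (le_lt_trans (bnd _ thh _ hh) (lt_trans hN hr1)).
have bnd2 := bnd _ thh _ z0h; rewrite scale0r addr0 in bnd2.
have A2 := H1 (th *: v) (le_lt_trans bnd2 (lt_trans hN hr1)).
rewrite (deriveE _ ddg) expr2.
have B1 := le_trans A1 (ler_wpM2l (ltW e1) (bnd _ thh _ hh)).
have B2 := le_trans A2 (ler_wpM2l (ltW e1) bnd2).
rewrite linearD !linearZ in B1; rewrite linearZ in B2.
move: ('D_v g (x + (th *: v + h *: w)) : R) ('D_v g (x + th *: v) : R)
  ('D_v g x : R) ('d ('D_v g) x v : R) ('d ('D_v g) x w : R) B1 B2 => a b c p q.
change (`|a - c - (th * p + h * q)| <= eps / (2 * N) * (h * (N - 1)) ->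
  `|b - c - th * p| <= eps / (2 * N) * (h * (N - 1)) ->
  `|(a - b) * h - h * h * q| <= eps * (h * h)) => B1 B2.
have B3 : eps / (2 * N) * (h * (N - 1)) <= eps * h / 2.
  rewrite [leRHS](_ : _ = eps / (2 * N) * (h * N)); last first.
    by field; rewrite gt_eqF.
  by rewrite ler_wpM2l ?(ltW e1)// (ltW hN).
have -> : (a - b) * h - h * h * q = h * (a - b - h * q) by ring.
rewrite normrM (gtr0_norm h0) mulrCA ler_pM2l //.
move: (le_trans B1 B3) (le_trans B2 B3); rewrite !ler_norml; clear.
move: (th * p) (h * q) (eps * h) => u z y.
move=> /andP[? ?] /andP[? ?]; apply/andP; split; lra.
Qed.

Lemma dist_le_of_approx (x k e D1 D2 : R) : 0 < k ->
  `|x - k * D1| <= e / 2 * k -> `|x - k * D2| <= e / 2 * k ->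
  `|D1 - D2| <= e.
Proof.
move=> k0 H1 H2; rewrite -(ler_pM2l k0) -{1}(gtr0_norm k0) -normrM.
have -> : k * (D1 - D2) = (x - k * D2) - (x - k * D1) by ring.
rewrite (le_trans (ler_normB _ _)) // [k * e](_ : _ = e / 2 * k + e / 2 * k).
  exact: lerD.
by field.
Qed.

(** Symmetry of second derivatives, in Young's form: the second difference is
    symmetric in v and w, and approximates h^2 times either mixed derivative. *)
Lemma derive_swap {E : normedModType R} (g : E -> R) (x v w : E) :
  (\forall z \near x, differentiable g z) ->
  differentiable ('D_v g) x -> differentiable ('D_w g) x ->
  'D_w ('D_v g) x = 'D_v ('D_w g) x.
Proof.
move=> dg dv dw; apply/eqP; rewrite -subr_eq0 -normr_le0.
apply/ler_addgt0Pl => e e0; rewrite addr0.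
have e2 : 0 < e / 2 by rewrite divr_gt0.
have [d1 d10 H1] := second_difference w e2 dg dv.
have [d2 d20 H2] := second_difference v e2 dg dw.
pose h := Num.min d1 d2 / 2.
have m0 : 0 < Num.min d1 d2 by rewrite lt_min d10.
have h0 : 0 < h by rewrite divr_gt0.
have hm : h < Num.min d1 d2 by rewrite /h; lra.
move: (hm); rewrite lt_min => /andP[hd1 hd2].
have := H1 h; rewrite h0 hd1 => /(_ isT) B1.
have := H2 h; rewrite h0 hd2 => /(_ isT).
rewrite (addrAC x (h *: w)) (addrAC (g _) (- g (x + h *: w))) => B2.
apply: (dist_le_of_approx _ B1 B2); exact: exprn_gt0.
Qed.

End Calculus.

Section Derive.
Context {R : realType}.

Lemma derive_comp {E F G : normedModType R} (f : E -> F) (g : F -> G) (x v : E) :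
  differentiable f x -> differentiable g (f x) ->
  'D_v (fun z => g (f z)) x = 'D_('D_v f x) g (f x).
Proof.
move=> df dg; have dgf : differentiable (g \o f) x by exact: differentiable_comp.
by rewrite (deriveE _ dgf) (deriveE _ dg) (deriveE _ df) diff_comp.
Qed.

(** The two difference quotients are equal as functions, so the limits agree
    even when they are meaningless. *)
Lemma derive_fst {E F G : normedModType R} (g : E * F -> G) (x v : E) (y : F) :
  'D_(v, 0) g (x, y) = 'D_v (fun z => g (z, y)) x.
Proof.
apply: (f_equal (fun F : R -> G => lim (F @ 0^'))); apply/funext => h /=.
by congr (_ *: (g _ - _)); congr pair; rewrite /= scaler0 add0r.
Qed.

Lemma derive_snd {E F G : normedModType R} (g : E * F -> G) (x : E) (y v : F) :
  'D_(0, v) g (x, y) = 'D_v (fun z => g (x, z)) y.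
Proof.
apply: (f_equal (fun F : R -> G => lim (F @ 0^'))); apply/funext => h /=.
by congr (_ *: (g _ - _)); congr pair; rewrite /= scaler0 add0r.
Qed.

Lemma is_derive_pair {E F : normedModType R} (f : R -> E) (g : R -> F) (t : R) df dg :
  is_derive t 1 f df -> is_derive t 1 g dg ->
  is_derive t 1 (fun s => (f s, g s)) (df, dg).
Proof.
move=> [/derivable1_diffP f1 <-] [/derivable1_diffP g1 <-].
have d := differentiable_pair f1 g1.
split; first exact/derivable1_diffP.
by rewrite (deriveE _ d) diff_pair //= !deriveE.
Qed.

Lemma differentiable_pairl {E F : normedModType R} (x : E) (y : F) :
  differentiable (fun z => (z, y)) x.
Proof. by apply: differentiable_pair => //; exact: differentiable_cst. Qed.

Lemma differentiable_pairr {E F : normedModType R} (x : E) (y : F) :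
  differentiable (fun z => (x, z)) y.
Proof. by apply: differentiable_pair => //; exact: differentiable_cst. Qed.

End Derive.

Lemma continuous_pair {T U V : topologicalType} (f : T -> U) (g : T -> V) (x : T) :
  {for x, continuous f} -> {for x, continuous g} ->
  {for x, continuous (fun z => (f z, g z))}.
Proof. by move=> cf cg; exact: (cvg_pair cf cg). Qed.

Section IsDerive.
Context {R : realType} {E : normedModType R}.

Lemma is_derive_diff (f : E -> R) x v :
  differentiable f x -> is_derive x v f ('D_v f x).
Proof. by move=> df; exact/derivableP/diff_derivable. Qed.

Lemma is_derive_sumf (I : Type) (r : seq I) (f : I -> E -> R) (df : I -> R) x v :
  (forall k, is_derive x v (f k) (df k)) ->
  is_derive x v (fun z => \sum_(k <- r) f k z) (\sum_(k <- r) df k).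
Proof.
move=> H; elim: r => [|k r IH].
  rewrite big_nil (_ : (fun _ => _) = cst 0); first exact: is_derive_cst.
  by apply/funext => z; rewrite big_nil.
rewrite big_cons (_ : (fun _ => _) = f k + (fun z => \sum_(j <- r) f j z)).
  exact: is_deriveD.
by apply/funext => z; rewrite big_cons.
Qed.

Lemma is_deriveMf (f g : E -> R) x v (df dg : R) :
  is_derive x v f df -> is_derive x v g dg ->
  is_derive x v (fun z => f z * g z) (df * g x + f x * dg).
Proof.
move=> Df Dg; apply: (is_derive_eq (is_deriveM Df Dg)).
by rewrite -![_ *: _]/(_ * _) addrC [g x * _]mulrC.
Qed.

Lemma differentiable_sumf (I : Type) (r : seq I) (f : I -> E -> R) x :
  (forall k, differentiable (f k) x) ->
  differentiable (fun z => \sum_(k <- r) f k z) x.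
Proof.
move=> H; elim: r => [|k r IH].
  rewrite (_ : (fun _ => _) = cst 0); first exact: differentiable_cst.
  by apply/funext => z; rewrite big_nil.
rewrite (_ : (fun _ => _) = f k + (fun z => \sum_(j <- r) f j z)).
  exact: differentiableD.
by apply/funext => z; rewrite big_cons.
Qed.

End IsDerive.

Section Coordinates.
Context {R : realType} {n : nat}.

Lemma derive_rV {F : normedModType R} (f : 'rV[R]_n -> F) (x v : 'rV[R]_n) :
  differentiable f x ->
  'D_v f x = \sum_k v 0 k *: 'D_(delta_mx 0 k) f x.
Proof.
move=> df; rewrite deriveE // {1}(row_sum_delta v) linear_sum.
by apply: eq_bigr => k _; rewrite linearZ /= deriveE.
Qed.

Lemma derive_coord {E : normedModType R} (m : nat) (f : E -> 'rV[R]_m) (x v : E) k :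
  derivable f x v -> ('D_v f x) 0 k = 'D_v (fun z => f z 0 k) x.
Proof. by move=> df; rewrite derive_mx // mxE. Qed.

Lemma is_derive_row_coord (y v : 'rV[R]_n) k :
  is_derive y v (fun z => z 0 k) (v 0 k).
Proof.
apply: DeriveDef; first exact/diff_derivable/differentiable_coord.
by rewrite -(derive_coord _ (@derivable_id _ _ y v)) derive_id.
Qed.

End Coordinates.

(** * The algebra of smooth functions *)

Section SmoothAlgebra.
Context {R : realType} {E : normedModType R}.

(** Differentiability is local: a map that agrees with [f] near [x] has the
    same first order expansion there. *)
Lemma near_eq_differentiable {F : normedModType R} (f g : E -> F) (x : E) :
  (\near x, f x = g x) -> differentiable f x -> differentiable g x.
Proof.
move=> fg df; have fgx := nbhs_singleton fg.
have Hg : g \o shift x = cst (g x) + 'd f x +o_ 0 id.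
  apply/eqaddoP => e e0.
  move: fg; rewrite (near_shift 0) subr0 => fg.
  apply: filterS2 fg ((eqaddoP _ _ _ _).1 (diff_locally df) _ e0) => h.
  by rewrite !fctE /= fgx => ->.
have [dc _] := (diff_locallyP _ _).1 df.
by apply/diff_locallyP; rewrite (diff_unique dc Hg); split.
Qed.

(** The workhorse of this part: each rule of differential calculus holds on
    [U] only, and this lemma lets it be used under further derivatives. *)
Lemma Ck_on_eq {F : normedModType R} (k : nat) (U : set E) (f g : E -> F) :
  open U -> (forall x, U x -> f x = g x) -> Ck_on k U f -> Ck_on k U g.
Proof.
move=> oU; elim: k f g => [|k IH] f g fg /=.
  move=> cf x Ux; rewrite /prop_for /continuous_at -fg //.
  apply: cvg_trans (cf x Ux); apply: near_eq_cvg.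
  by near=> z; apply: fg; near: z; exact: open_nbhs_nbhs.
have nfg x : U x -> \near x, f x = g x.
  by move=> Ux; near=> z; apply: fg; near: z; exact: open_nbhs_nbhs.
move=> [df Df]; split=> [x Ux|v].
  by apply: near_eq_differentiable (df x Ux); exact: nfg.
apply: IH (Df v) => x Ux; exact/near_eq_derive/nfg.
Unshelve. all: by end_near. Qed.

Lemma Ck_onS {F : normedModType R} (k : nat) (U : set E) (f : E -> F) :
  Ck_on k.+1 U f -> Ck_on k U f.
Proof.
elim: k f => [|k IH] f [df Df].
  by move=> x Ux; exact/differentiable_continuous/df.
by split=> // v; exact/IH/Df.
Qed.

Variable U : set E.
Hypothesis oU : open U.

Lemma Ck_on_cst (a : R) (k : nat) : Ck_on k U (fun _ : E => a).
Proof.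
elim: k a => [|k IH] a /=; first by move=> x _; exact: cvg_cst.
split=> [x _|v]; first exact: differentiable_cst.
apply: (Ck_on_eq oU) (IH 0) => x _.
by rewrite (derive_cst a x v).
Qed.

Lemma Ck_onD (k : nat) (f g : E -> R) :
  Ck_on k U f -> Ck_on k U g -> Ck_on k U (fun x => f x + g x).
Proof.
elim: k f g => [|k IH] f g /=.
  by move=> cf cg x Ux; apply: cvgD; [exact: cf|exact: cg].
move=> [df Df] [dg Dg]; split=> [x Ux|v].
  by apply: differentiableD; [exact: df|exact: dg].
apply: (Ck_on_eq oU) (IH _ _ (Df v) (Dg v)) => x Ux.
by rewrite [RHS]deriveD //; apply: diff_derivable; [exact: df|exact: dg].
Qed.

Lemma Ck_onM (k : nat) (f g : E -> R) :
  Ck_on k U f -> Ck_on k U g -> Ck_on k U (fun x => f x * g x).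
Proof.
elim: k f g => [|k IH] f g.
  by move=> cf cg x Ux; apply: cvgM; [exact: cf|exact: cg].
move=> cf cg; have [df Df] := cf; have [dg Dg] := cg; split=> [x Ux|v].
  by apply: differentiableM; [exact: df|exact: dg].
have := Ck_onD (IH _ _ (Ck_onS cf) (Dg v)) (IH _ _ (Ck_onS cg) (Df v)).
apply: (Ck_on_eq oU) => x Ux.
by rewrite [RHS]deriveM //; apply: diff_derivable; [exact: df|exact: dg].
Qed.

Lemma Ck_on_sum (I : Type) (r : seq I) (k : nat) (f : I -> E -> R) :
  (forall i, Ck_on k U (f i)) -> Ck_on k U (fun x => \sum_(i <- r) f i x).
Proof.
move=> cf; elim: r => [|i r IH].
  by apply: (Ck_on_eq oU) (Ck_on_cst 0 k) => x _; rewrite big_nil.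
by apply: (Ck_on_eq oU) (Ck_onD (cf i) IH) => x _; rewrite big_cons.
Qed.

Lemma Ck_onV (k : nat) (f : E -> R) : (forall x, U x -> f x != 0) ->
  Ck_on k U f -> Ck_on k U (fun x => (f x)^-1).
Proof.
move=> f0; elim: k => [|k IH].
  by move=> cf x Ux; apply: cvgV; [exact: f0|exact: cf].
move=> cf; have [df Df] := cf; split=> [x Ux|v].
  by apply: differentiableV; [exact: df|exact: f0].
have cV := IH (Ck_onS cf).
have := Ck_onM (Ck_on_cst (-1) k) (Ck_onM (Ck_onM cV cV) (Df v)).
apply: (Ck_on_eq oU) => x Ux.
rewrite deriveV; [|exact: f0|exact/diff_derivable/df].
by rewrite -[RHS]/(_ * _) expr2 invfM mulN1r mulNr.
Qed.

Lemma Ck_on_coord (n m : nat) (k : nat) (f : E -> 'M[R]_(n, m)) i j :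
  Ck_on k U f -> Ck_on k U (fun x => f x i j).
Proof.
elim: k f => [|k IH] f.
  move=> cf x Ux; apply: (@continuous_comp _ _ _ f (fun M => M i j)).
    exact: cf.
  exact: coord_continuous.
move=> [df Df]; split=> [x Ux|v].
  apply: (@differentiable_comp _ _ _ _ f (fun M : 'M[R]_(n, m) => M i j)).
    exact: df.
  exact: differentiable_coord.
apply: (Ck_on_eq oU) (IH _ (Df v)) => x Ux.
by rewrite derive_mx ?mxE //; exact/diff_derivable/df.
Qed.

End SmoothAlgebra.

(** * Primitives and linear differential equations *)

Section Primitive.
Context {R : realType}.
Local Notation mu := (@lebesgue_measure R).

(** The integral of [k] from 0 needs a sign convention for negative times; near
    any given time it differs by a constant from the integral over [a, t], where
    [a] is a point of [J] to the left of both 0 and that time, so that the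
    fundamental theorem of calculus applies. *)
Lemma primitive (J : set R) (k : R -> R) :
  open J -> is_interval J -> J 0 -> (forall t, J t -> {for t, continuous k}) ->
  exists K : R -> R, K 0 = 0 /\ forall t, J t -> is_derive t 1 K (k t).
Proof.
move=> oJ iJ J0 ck.
pose I a b := (\int[mu]_(x in `[a, b]) k x)%R.
have integ a b : J a -> J b -> mu.-integrable `[a, b] (EFin \o k).
  move=> Ja Jb; apply: continuous_compact_integrable.
    exact: segment_compact.
  apply: continuous_in_subspaceT => x.
  by rewrite inE /= in_itv /= => axb; apply: ck; apply: (iJ a b).
have split a b c : J a -> J c -> a <= b <= c -> I a c - I a b = I b c.
  move=> Ja Jc /andP[ab bc].
  have Jb : J b by apply: (iJ a c) => //; rewrite ab.
  rewrite /I (Rintegral_itvB (integ _ _ Ja Jc)) ?bnd_simp //.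
  rewrite Rintegral_itv_obnd_cbnd //.
  apply: integrableS (integ _ _ Jb Jc) => //.
  exact: subset_itv_oc_cc.
exists (fun t => if 0 <= t then I 0 t else - I t 0); split.
  by rewrite lexx /I set_itv1 Rintegral_set1.
have ball t : J t -> exists2 e : R, 0 < e & forall s, `|t - s| < e -> J s.
  move=> Jt; have /nbhs_ballP[e /= e0 H] := open_nbhs_nbhs (conj oJ Jt).
  by exists e.
move=> t Jt; have [e e0 He] := ball _ Jt; have [d d0 Hd] := ball _ J0.
have [a [Ja at' a0]] : exists a, [/\ J a, a < t & a < 0].
  case: (leP 0 t) => t0.
    exists (- (d / 2)); split; [|lra|lra].
    by apply: Hd; rewrite sub0r opprK gtr0_norm; lra.
  exists (t - e / 2); split; [|lra|lra].
  by apply: He; rewrite opprB addrC subrK gtr0_norm; lra.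
have Ju : J (t + e / 2).
  by apply: He; rewrite opprD addNKr normrN gtr0_norm; lra.
have tu : t < t + e / 2 by lra.
have [dF F't] := continuous_FTC1_closed tu (integ _ _ Ja Ju) at' (ck _ Jt).
have dI : is_derive t 1 (fun s => I a s - I a 0) (k t).
  apply: (@is_derive_eq _ _ _ _ _ _ _ (k t - 0)); last by rewrite subr0.
  apply: is_deriveB; split; first exact: dF.
  by rewrite -derive1E.
apply: near_eq_is_derive dI.
near=> s.
have sa : a < s by near: s; exact: lt_nbhsr.
have Js : J s by near: s; exact: open_nbhs_nbhs.
case: (leP 0 s) => s0.
  by apply: split; rewrite ?(ltW a0).
by rewrite -(split a s 0) // ?opprB // (ltW sa) ltW.
Unshelve. all: by end_near. Qed.

Lemma derive0_cst (J : set R) (f : R -> R) :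
  is_interval J -> (forall t, J t -> is_derive t 1 f 0) ->
  forall s t, J s -> J t -> f s = f t.
Proof.
move=> iJ df s t; wlog st : s t / s <= t.
  move=> H Js Jt; case: (leP s t) => [|/ltW] st; first exact: H.
  by apply/esym; exact: H.
move=> Js Jt.
have Jst x : x \in `[s, t] -> J x.
  by rewrite in_itv /= => sxt; apply: (iJ s t).
have [|x _] := @MVT_segment _ f (fun=> 0) _ _ st (fun x xst =>
  df x (Jst x (subset_itv_oo_cc xst))).
  by apply: derivable_within_continuous => x /Jst /df [].
by rewrite mul0r => /eqP; rewrite subr_eq0 => /eqP.
Qed.

End Primitive.

Section RealLine.
Context {R : realType}.

Lemma is_derive_lnf (f : R -> R) (t df : R) : 0 < f t -> is_derive t 1 f df ->
  is_derive t 1 (fun s => ln (f s)) ((f t)^-1 * df).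
Proof. by move=> f0 Df; exact: is_derive1_comp (is_derive1_ln f0) Df. Qed.

Lemma is_derive_expRf (f : R -> R) (t df : R) : is_derive t 1 f df ->
  is_derive t 1 (fun s => expR (f s)) (expR (f t) * df).
Proof. by move=> Df; exact: is_derive1_comp (is_derive_expR (f t)) Df. Qed.

Lemma is_derive_inv (f : R -> R) (t df : R) : f t != 0 -> is_derive t 1 f df ->
  is_derive t 1 (fun s => (f s)^-1) (- (f t) ^- 2 * df).
Proof. by move=> f0 Df; exact: is_deriveV f0 Df. Qed.

Lemma is_deriveBf (f g : R -> R) (t df dg : R) : is_derive t 1 f df ->
  is_derive t 1 g dg -> is_derive t 1 (fun s => f s - g s) (df - dg).
Proof. by move=> Df Dg; exact: is_deriveB. Qed.

Lemma is_deriveDf (f g : R -> R) (t df dg : R) : is_derive t 1 f df ->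
  is_derive t 1 g dg -> is_derive t 1 (fun s => f s + g s) (df + dg).
Proof. by move=> Df Dg; exact: is_deriveD. Qed.

Lemma is_deriveZf (f : R -> R) (k t df : R) : is_derive t 1 f df ->
  is_derive t 1 (fun s => k * f s) (k * df).
Proof. by move=> Df; exact: is_deriveZ. Qed.

(** The usual integrating factor: the product of [z] and exp (- K) is
    constant. *)
Lemma linear_ode (J : set R) (z k K : R -> R) :
  is_interval J -> J 0 -> K 0 = 0 ->
  (forall t, J t -> is_derive t 1 K (k t)) ->
  (forall t, J t -> is_derive t 1 z (k t * z t)) ->
  forall t, J t -> z t = expR (K t) * z 0.
Proof.
move=> iJ J0 K0 DK Dz t Jt.
have D s : J s -> is_derive s 1 (fun u => expR (- 1 * K u) * z u) 0.
  move=> Js; apply: is_derive_eq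
    (is_deriveMf (is_derive_expRf (is_deriveZf (-1) (DK _ Js))) (Dz _ Js)) _.
  ring.
have := derive0_cst iJ D Jt J0.
rewrite K0 mulr0 expR0 mul1r mulN1r => <-.
by rewrite mulrA -expRD subrr expR0 mul1r.
Qed.

Lemma derive_at_local_min (f df : R -> R) (t0 : R) :
  (\forall t \near t0, is_derive t (1 : R) f (df t) /\ f t0 <= f t) -> df t0 = 0.
Proof.
move=> /nbhs_ballP[e /= e0 H].
have tin t : t \in `]t0 - e, t0 + e[ -> is_derive t 1 f (df t) /\ f t0 <= f t.
  rewrite in_itv /= => /andP[te1 te2]; apply: H.
  by rewrite /ball /= ltr_norml; apply/andP; split; lra.
have t0in : t0 \in `]t0 - e, t0 + e[ by rewrite in_itv /=; apply/andP; split; lra.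
have [_ E1] := (tin _ t0in).1.
have le : t0 - e <= t0 + e by lra.
have [_ E2] := @derive1_at_min _ f _ _ _ le (fun t ti => @ex_derive _ _ _ _ _ _ _ (tin t ti).1)
  t0in (fun t ti => (tin t ti).2).
by rewrite -E1 E2.
Qed.

End RealLine.

(** * The flow and the complete lift *)

Section Flow.
Context {R : realType} {n : nat} {M : manifold R n}.
Implicit Types (i j : chidx M) (p q : M) (y : 'rV[R]_n).

Lemma chinvK i u : chimg i u -> chart i (chinv i u) = u.
Proof. by move=> [q qi <-]; rewrite chartK. Qed.

Lemma chdom_chinv i u : chimg i u -> chdom i (chinv i u).
Proof. by move=> [q qi <-]; rewrite chartK. Qed.

Lemma chimg_chart i p : chdom i p -> chimg i (chart i p).
Proof. by move=> pi; exists p. Qed.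

Lemma near_chdom i p : chdom i p -> \forall q \near p, chdom i q.
Proof. by move=> pi; apply: open_nbhs_nbhs; split=> //; exact: chdom_open. Qed.

Lemma differentiable_chart_change i j p : chdom i p -> chdom j p ->
  differentiable (chart j \o chinv i) (chart i p).
Proof.
by move=> pi pj; have [d _] := @chart_compatible _ _ M i j 1; apply: d; exists p.
Qed.

Lemma tchange_id i p y : chdom i p -> tchange i i p y = y.
Proof.
move=> pi; rewrite /tchange -[RHS](derive_id (chart i p) y).
apply: near_eq_derive; have := open_nbhs_nbhs (conj (@chimg_open _ _ M i) (chimg_chart pi)).
by apply: filterS => u /chinvK.
Qed.

Variables (V : vector_field M) (phi : flow V).

Lemma differentiable_vcomp j p : chdom j p ->
  differentiable (fun u => V j (chinv j u)) (chart j p).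
Proof.
by move=> pj; have [d _] := vcomp_smooth V j 1; apply: d; exact: chimg_chart.
Qed.

Local Notation fmap := Defs.fmap.

Let G i j (w : R * 'rV[R]_n) := chart j (fmap phi w.1 (chinv i w.2)).
Let W i j : set (R * 'rV[R]_n) := [set w | [/\ chimg i w.2,
  fdom phi (w.1, chinv i w.2) & chdom j (fmap phi w.1 (chinv i w.2))]].

(** The set on which the flow, read in the charts [i] and [j], is known to be
    smooth is a neighbourhood of each of its points. *)
Lemma near_flow_dom i j w : W i j w -> \forall z \near w, W i j z.
Proof.
move=> [wi wd wj].
have ci : {for w, continuous (fun z : R * 'rV[R]_n => (z.1, chinv i z.2))}.
  apply: continuous_pair; first exact: cvg_fst.
  apply: (@continuous_comp _ _ _ (@snd R 'rV[R]_n) (chinv i)); first exact: cvg_snd.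
  exact: (@chinv_continuous _ _ M i).
have n1 : \forall z \near w, chimg i z.2.
  have c2 : {for w, continuous (@snd R 'rV[R]_n)} by exact: cvg_snd.
  apply: (c2 (chimg i)); apply: open_nbhs_nbhs.
  by split=> //; exact: chimg_open.
have n2 : \forall z \near w, fdom phi (z.1, chinv i z.2).
  apply: (ci (fdom phi)); apply: open_nbhs_nbhs; split=> //; exact: fdom_open.
have n3 : \forall z \near w, chdom j (fmap phi z.1 (chinv i z.2)).
  have cc := @continuous_comp _ _ _ (fun z : R * 'rV[R]_n => (z.1, chinv i z.2))
    (fun w : R * M => fmap phi w.1 w.2) w ci (fmap_continuous wd).
  by apply: (cc (chdom j)); exact: near_chdom.
by apply: filterS3 n1 n2 n3 => z; split.
Qed.

Lemma differentiable_flow i j w : W i j w -> differentiable (G i j) w.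
Proof. by move=> Ww; have [d _] := @fmap_smooth _ _ _ _ phi i j 1; apply: d. Qed.

Lemma derive_flow_time i j w : W i j w ->
  'D_(1, 0) (G i j) w = V j (chinv j (G i j w)).
Proof.
case: w => t u [/= ui ud uj]; rewrite derive_fst /G /= chartK //.
by have [_ /(_ _ uj)[]] := fmap_integral (p := chinv i u) ud.
Qed.

Lemma flow_dom_chart i j t p : chdom i p -> fdom phi (t, p) ->
  chdom j (fmap phi t p) -> W i j (t, chart i p).
Proof. by move=> pi pd pj; split => /=; rewrite ?chartK //; exact: chimg_chart. Qed.

Lemma pushE t i j p y : push phi t i j p y = 'D_(0, y) (G i j) (t, chart i p).
Proof. by rewrite derive_snd. Qed.

Lemma push0 i j p y : push phi 0 i j p y = tchange i j p y.
Proof.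
apply: (f_equal (fun f => 'D_y f (chart i p))).
by apply/funext => u; rewrite fmap0.
Qed.

(** Chain rule for the change of target chart. *)
Lemma push_change t i j j' p y : chdom i p -> fdom phi (t, p) ->
  chdom j (fmap phi t p) -> chdom j' (fmap phi t p) ->
  push phi t i j' p y = tchange j j' (fmap phi t p) (push phi t i j p y).
Proof.
move=> pi pd pj pj'; have Wp := flow_dom_chart pi pd pj.
have dG : differentiable (fun u => G i j (t, u)) (chart i p).
  apply: (@differentiable_comp _ _ _ _ (fun u => (t, u)) (G i j)).
    exact: differentiable_pairr.
  exact: differentiable_flow.
have GE : G i j (t, chart i p) = chart j (fmap phi t p) by rewrite /G /= chartK.
have dT : differentiable (chart j' \o chinv j) (G i j (t, chart i p)).
  by rewrite GE; exact: differentiable_chart_change.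
have H : 'D_y (fun u => (chart j' \o chinv j) (G i j (t, u))) (chart i p) =
    tchange j j' (fmap phi t p) (push phi t i j p y).
  by rewrite (derive_comp _ dG dT) GE.
apply: etrans H; apply: near_eq_derive.
have ct : {for chart i p, continuous (fun u : 'rV[R]_n => (t, u))}.
  exact/differentiable_continuous/differentiable_pairr.
have nW : \forall u \near chart i p, W i j (t, u) := ct _ (near_flow_dom Wp).
by apply: filterS nW => u [/= _ _ uj]; rewrite chartK.
Qed.

(** The variational equation.  The push-forward is the derivative of the flow
    in the space direction y; exchanging it with the time derivative gives the
    derivative in the direction y of V along the flow, that is, of V in the
    direction of the pushed vector. *)
Lemma is_derive_push t i j p y : chdom i p -> fdom phi (t, p) ->
  chdom j (fmap phi t p) ->
  is_derive t 1 (fun s => push phi s i j p y)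
    ('D_(push phi t i j p y) (fun u => V j (chinv j u)) (chart j (fmap phi t p))).
Proof.
move=> pi pd pj; have Wp := flow_dom_chart pi pd pj.
set w0 := (t, chart i p) in Wp.
have dG := differentiable_flow Wp.
have dDG v : differentiable ('D_v (G i j)) w0.
  have [_ /(_ v)[d _]] := @fmap_smooth _ _ _ _ phi i j 2.
  exact: d.
have GE : G i j w0 = chart j (fmap phi t p) by rewrite /G /= chartK.
have dV : differentiable (fun u => V j (chinv j u)) (G i j w0).
  by rewrite GE; exact: differentiable_vcomp.
have -> : 'D_(push phi t i j p y) (fun u => V j (chinv j u)) (chart j (fmap phi t p)) =
    'D_(0, y) (fun z => V j (chinv j (G i j z))) w0.
  by rewrite pushE -GE (derive_comp _ dG dV).
apply: (@is_derive_eq _ _ _ _ _ _ _ ('D_(1, 0) ('D_(0, y) (G i j)) w0)).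
  rewrite (_ : (fun s => _) = fun s => 'D_(0, y) (G i j) (s, chart i p)); last first.
    by apply/funext => s; rewrite pushE.
  apply: (@is_derive_curve _ _ _ _ (fun s => (s, chart i p))) => //.
  exact: is_derive_pair.
apply/rowP => k.
have nG : \forall z \near w0, differentiable (G i j) z.
  by apply: filterS (near_flow_dom Wp) => z; exact: differentiable_flow.
have dc (v : R * 'rV[R]_n) :
    \forall z \near w0, 'D_v (G i j) z 0 k = 'D_v (fun z => G i j z 0 k) z.
  by apply: filterS nG => z dz; apply: derive_coord; exact: diff_derivable.
have dcoord (F : R * 'rV[R]_n -> 'rV[R]_n) z : differentiable F z ->
    differentiable (fun z => F z 0 k) z.
  move=> dF; apply: (@differentiable_comp _ _ _ _ F (fun N : 'rV[R]_n => N 0 k)) => //.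
  exact: differentiable_coord.
have dDg v : differentiable ('D_v (fun z => G i j z 0 k)) w0.
  by apply: near_eq_differentiable (dc v) _; exact: dcoord.
rewrite derive_coord; last exact: diff_derivable.
rewrite (near_eq_derive _ (dc _)) derive_swap //; last first.
  by apply: filterS nG => z; exact: dcoord.
have dVG : \forall z \near w0, 'D_(1, 0) (fun z => G i j z 0 k) z =
    V j (chinv j (G i j z)) 0 k.
  apply: filterS2 (dc (1, 0)) (near_flow_dom Wp) => z <- Wz.
  by rewrite derive_flow_time.
have dVG0 : differentiable (fun z => V j (chinv j (G i j z))) w0.
  exact: (@differentiable_comp _ _ _ _ (G i j) (fun u => V j (chinv j u))).
by rewrite (near_eq_derive _ dVG) -derive_coord //; exact: diff_derivable.
Qed.

Lemma is_derive_flow t j p : fdom phi (t, p) -> chdom j (fmap phi t p) ->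
  is_derive t 1 (fun s => chart j (fmap phi s p)) (V j (fmap phi t p)).
Proof. by move=> pd; have [_] := fmap_integral pd; exact. Qed.

Lemma near_flow t j p : fdom phi (t, p) -> chdom j (fmap phi t p) ->
  \forall s \near t, fdom phi (s, p) /\ chdom j (fmap phi s p).
Proof.
move=> pd pj; apply: filterI; last first.
  by have [c _] := fmap_integral pd; apply: (c (chdom j)); exact: near_chdom.
have ct : {for t, continuous (fun s : R => (s, p))}.
  by apply: continuous_pair; [exact: cvg_id|exact: cvg_cst].
by apply: (ct (fdom phi)); apply: open_nbhs_nbhs; split => //; exact: fdom_open.
Qed.

Definition tm_differentiable (f : tmfun M) := forall j q z, chdom j q ->
  differentiable (fun w : 'rV[R]_n * 'rV[R]_n => f j (chinv j w.1) w.2) (chart j q, z).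

(** [f] is a genuine function on TM: its values in different charts agree. *)
Definition tm_invariant (f : tmfun M) := forall i j p y, chdom i p -> chdom j p ->
  f j p (tchange i j p y) = f i p y.

(** In a chart, V^c f is the derivative of f in the direction (V, DV y) of the
    product of the base and the fibre. *)
Lemma complete_liftE (f : tmfun M) j q z : tm_differentiable f -> chdom j q ->
  complete_lift V f j q z =
  'D_(V j q, 'D_z (fun u => V j (chinv j u)) (chart j q))
    (fun w : 'rV[R]_n * 'rV[R]_n => f j (chinv j w.1) w.2) (chart j q, z).
Proof.
move=> df qj; have dfq := df _ _ z qj.
set F := (fun w : 'rV[R]_n * 'rV[R]_n => _) in dfq *.
set X := 'D_z _ _.
have -> : (V j q, X) = (V j q, 0) + (0, X) by congr pair; rewrite /= ?addr0 ?add0r.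
rewrite (deriveE _ dfq) linearD -!deriveE // derive_fst derive_snd.
have dF1 : differentiable (fun u => F (u, z)) (chart j q).
  apply: (@differentiable_comp _ _ _ _ (fun u => (u, z)) F).
    exact: differentiable_pairl.
  exact: dfq.
have dF2 : differentiable (fun u => F (chart j q, u)) z.
  apply: (@differentiable_comp _ _ _ _ (fun u => (chart j q, u)) F).
    exact: differentiable_pairr.
  exact: dfq.
rewrite (derive_rV _ dF1) (derive_rV _ dF2) /complete_lift; congr (_ + _).
rewrite exchange_big /=; apply: eq_bigr => l _.
rewrite -mulr_suml /F /= chartK // -[RHS]/(_ * _); congr (_ * _).
rewrite /X derive_coord; last exact/diff_derivable/differentiable_vcomp.
rewrite derive_rV //.
apply: (@differentiable_comp _ _ _ _ _ (fun N : 'rV[R]_n => N 0 l)).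
  exact: differentiable_vcomp.
exact: differentiable_coord.
Qed.

(** The complete lift generates the transport of functions on TM along the
    flow: the pair (base point, pushed vector) moves with velocity (V, DV y). *)
Lemma is_derive_push_tm (f : tmfun M) t i j p y : tm_differentiable f ->
  chdom i p -> fdom phi (t, p) -> chdom j (fmap phi t p) ->
  is_derive t 1 (fun s => f j (fmap phi s p) (push phi s i j p y))
    (complete_lift V f j (fmap phi t p) (push phi t i j p y)).
Proof.
move=> df pi pd pj; rewrite complete_liftE //.
set F := (fun w : 'rV[R]_n * 'rV[R]_n => _).
have := @is_derive_curve _ _ _ F
  (fun s => (chart j (fmap phi s p), push phi s i j p y)) t _
  (is_derive_pair (is_derive_flow pd pj) (is_derive_push y pi pd pj))
  (df _ _ _ pj).
apply: near_eq_is_derive.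
by apply: filterS (near_flow pd pj) => s [_ sj]; rewrite /F /= chartK.
Qed.

Lemma tm_invariant_push (f : tmfun M) t i j j' p y : tm_invariant f ->
  chdom i p -> fdom phi (t, p) ->
  chdom j (fmap phi t p) -> chdom j' (fmap phi t p) ->
  f j' (fmap phi t p) (push phi t i j' p y) = f j (fmap phi t p) (push phi t i j p y).
Proof. by move=> fi pi pd pj pj'; rewrite (push_change _ pi pd pj pj') fi. Qed.

(** Both sides are derivatives at t = 0 of one and the same function of time,
    read in two charts. *)
Lemma complete_lift_change (f : tmfun M) i j p y :
  tm_differentiable f -> tm_invariant f -> chdom i p -> chdom j p ->
  complete_lift V f j p (tchange i j p y) = complete_lift V f i p y.
Proof.
move=> df fi pi pj.
have pi0 : chdom i (fmap phi 0 p) by rewrite fmap0.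
have pj0 : chdom j (fmap phi 0 p) by rewrite fmap0.
have pd := fdom0 phi p.
have Di := is_derive_push_tm y df pi pd pi0.
have Dj := is_derive_push_tm y df pi pd pj0.
rewrite !push0 fmap0 tchange_id // in Di Dj.
have [_ <-] := Di; have [_ <-] := Dj.
apply: near_eq_derive; apply: filterS2 (near_flow pd pi0) (near_flow pd pj0).
by move=> s [sd si] [_ sj]; exact: tm_invariant_push.
Qed.

(** The value of [f] at the pushed vector, in whatever chart contains the end
    point: an orbit need not stay in the domain of a single chart. *)
Definition tm_along (f : tmfun M) i p y (t : R) : R :=
  let j := projT1 (cid (chdom_cover (fmap phi t p))) in
  f j (fmap phi t p) (push phi t i j p y).

Lemma tm_alongE (f : tmfun M) t i j p y : tm_invariant f ->
  chdom i p -> fdom phi (t, p) -> chdom j (fmap phi t p) ->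
  tm_along f i p y t = f j (fmap phi t p) (push phi t i j p y).
Proof.
move=> fi pi pd pj; rewrite /tm_along; case: cid => j' /= pj'.
exact: tm_invariant_push.
Qed.

Lemma tm_along0 (f : tmfun M) i p y : tm_invariant f -> chdom i p ->
  tm_along f i p y 0 = f i p y.
Proof.
move=> fi pi; rewrite (@tm_alongE _ _ _ i) //; last by rewrite fmap0.
  by rewrite push0 fmap0 tchange_id.
exact: fdom0.
Qed.

Lemma is_derive_tm_along (f : tmfun M) t i j p y :
  tm_differentiable f -> tm_invariant f ->
  chdom i p -> fdom phi (t, p) -> chdom j (fmap phi t p) ->
  is_derive t 1 (tm_along f i p y)
    (complete_lift V f j (fmap phi t p) (push phi t i j p y)).
Proof.
move=> df fi pi pd pj; apply: near_eq_is_derive (is_derive_push_tm y df pi pd pj).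
by apply: filterS (near_flow pd pj) => s [sd sj]; rewrite (tm_alongE _ fi pi sd sj).
Qed.

Lemma continuous_along_flow (c : M -> R) t p : smooth_fun c -> fdom phi (t, p) ->
  {for t, continuous (fun s => c (fmap phi s p))}.
Proof.
move=> hc pd; have [j pj] := chdom_cover (fmap phi t p).
have ck : {for chart j (fmap phi t p), continuous (c \o chinv j)}.
  by apply: (hc j 0); exact: chimg_chart.
have cf : {for t, continuous (fun s => chart j (fmap phi s p))}.
  have [d _] := is_derive_flow pd pj.
  exact/differentiable_continuous/derivable1_diffP.
have := continuous_comp cf ck.
rewrite /prop_for /continuous_at /= chartK //; apply: cvg_trans.
apply: near_eq_cvg; apply: filterS (near_flow pd pj) => s [_ sj] /=.
by rewrite chartK.
Qed.

End Flow.

(** * Linear and quadratic forms on a half-space *)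

Section Forms.
Context {R : realType} {n : nat}.
Implicit Types (l b : 'rV[R]_n -> R) (q r : 'rV[R]_n -> R) (y z : 'rV[R]_n).

(** Linear and quadratic forms are described by their restrictions to lines,
    which is the only way in which they are used. *)
Definition linear_form l := forall y z s, l (y + s *: z) = l y + s * l z.

Definition quadratic_form q := forall y z, exists c, forall s,
  q (y + s *: z) = q y + s * c + s ^+ 2 * q z.

Lemma linear_formZ l s y : linear_form l -> l (s *: y) = s * l y.
Proof.
move=> ll; have := ll 0 0 1; rewrite scaler0 addr0 mul1r => l0.
by rewrite -[s *: y]add0r ll [l 0](_ : _ = 0) ?add0r //; lra.
Qed.

Lemma quadratic_formM l l' : linear_form l -> linear_form l' ->
  quadratic_form (fun y => l y * l' y).
Proof.
move=> hl hl' y z; exists (l y * l' z + l z * l' y) => s.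
by rewrite hl hl'; ring.
Qed.

Lemma quadratic_formD_scaled q r s : quadratic_form q -> quadratic_form r ->
  quadratic_form (fun y => q y + s * r y).
Proof.
move=> hq hr y z; have [c hc] := hq y z; have [d hd] := hr y z.
by exists (c + s * d) => u; rewrite hc hd; ring.
Qed.

Lemma linear_form_proportional l b y0 : linear_form l -> linear_form b ->
  b y0 != 0 -> (forall z, b z = 0 -> l z = 0) ->
  forall y, l y = l y0 / b y0 * b y.
Proof.
move=> hl hb b0 H y; pose s := - (b y / b y0).
have : l (y + s *: y0) = 0 by apply: H; rewrite hb /s; field.
by rewrite hl /s => /eqP; rewrite addr_eq0 => /eqP ->; field.
Qed.

Lemma cubic_cst_eq0 (c0 c1 c2 c3 : R) :
  (forall s, 0 < s -> c0 + c1 * s + c2 * s ^+ 2 + c3 * s ^+ 3 = 0) -> c0 = 0.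
Proof.
move=> H; have := H 1 ltr01.
have := H 2 (ltr0Sn _ _); have := H 3 (ltr0Sn _ _); have := H 4 (ltr0Sn _ _).
move=> *; lra.
Qed.

(** Approach [z] from inside the half-space along z + s y0.  The identity
    becomes a cubic polynomial in s that vanishes for all s > 0, and its
    constant term is q z * l z. *)
Lemma cone_kernel q r l b y0 : quadratic_form q -> quadratic_form r ->
  linear_form l -> linear_form b -> 0 < b y0 ->
  (forall y, 0 < b y -> q y * l y + r y * b y = 0) ->
  forall z, b z = 0 -> q z * l z = 0.
Proof.
move=> hq hr hl hb b0 H z bz.
have [c hc] := hq z y0; have [d hd] := hr z y0.
apply: (@cubic_cst_eq0 _ (q z * l y0 + c * l z + r z * b y0)
  (c * l y0 + q y0 * l z + d * b y0) (q y0 * l y0 + r y0 * b y0)) => s s0.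
have : 0 < b (z + s *: y0) by rewrite hb bz add0r mulr_gt0.
by move=> /H; rewrite hc hd hl hb bz => <-; ring.
Qed.

(** From any [y], the line in the direction y0 ends up in the half-space, so
    the restriction of [q] to it vanishes for large parameters. *)
Lemma quadratic_form_cone_eq0 q b y0 : quadratic_form q -> linear_form b ->
  0 < b y0 -> (forall y, 0 < b y -> q y = 0) -> forall y, q y = 0.
Proof.
move=> hq hb b0 H y; have [c hc] := hq y y0.
(* Chosen so that b (y + s y0) >= 1; both s and s + 1 then give points of the
   half-space.  As q y0 = 0, the restriction is affine, and two zeros suffice. *)
pose s := (1 + `|b y|) / b y0.
have sb : s * b y0 = 1 + `|b y| by rewrite /s divfK // gt_eqF.
have E1 : q (y + s *: y0) = 0.
  by apply: H; rewrite hb sb; have := ler_norm (- b y); rewrite normrN; lra.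
have E2 : q (y + (s + 1) *: y0) = 0.
  apply: H; rewrite hb mulrDl sb mul1r.
  by have := ler_norm (- b y); rewrite normrN; lra.
move: E1 E2; rewrite !hc (H _ b0) !mulr0 !addr0 mulrDl.
have s0 : 0 < s by rewrite /s divr_gt0 // ltr_pwDl.
move=> E1 E2; have c0 : c = 0 by lra.
by move: E1; rewrite c0 mulr0 addr0.
Qed.

Lemma quadratic_form_mx (Q : 'M[R]_n) :
  quadratic_form (fun y => \sum_k \sum_l Q k l * y 0 k * y 0 l).
Proof.
move=> y z.
exists (\sum_k \sum_l (Q k l * y 0 k * z 0 l + Q k l * z 0 k * y 0 l)) => s.
rewrite !mulr_sumr -!big_split /=; apply: eq_bigr => k _.
rewrite !mulr_sumr -!big_split /=; apply: eq_bigr => l _.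
by rewrite !mxE; ring.
Qed.

End Forms.

(** * The functions alpha^2 and beta and their lifts *)

Section Lifts.
Context {R : realType} {n : nat} {M : manifold R n}.
Variables (a : riemannian_metric M) (b : one_form M).
Implicit Types (i j : chidx M) (p : M) (y : 'rV[R]_n).

Lemma beta_linear i p : linear_form (beta b i p).
Proof.
move=> y z s; rewrite /beta mulr_sumr -big_split /=.
by apply: eq_bigr => k _; rewrite !mxE; ring.
Qed.

Lemma alpha2_quadratic i p : quadratic_form (alpha2 a i p).
Proof. exact: quadratic_form_mx. Qed.

Lemma beta0 i p : beta b i p 0 = 0.
Proof. by rewrite /beta big1 // => k _; rewrite mxE mulr0. Qed.

Lemma alpha2_gt0 i p y : chdom i p -> 0 < beta b i p y -> 0 < alpha2 a i p y.
Proof.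
move=> pi by0; apply: acomp_pos => //; apply: contraTneq by0 => ->.
by rewrite beta0 ltxx.
Qed.

Lemma beta_invariant : tm_invariant (beta b).
Proof. by move=> i j p y pi pj; exact: bcomp_change. Qed.

Lemma alpha2_invariant : tm_invariant (alpha2 a).
Proof. by move=> i j p y pi pj; exact: acomp_change. Qed.

Lemma differentiable_bcomp i p k : chdom i p ->
  differentiable (fun u => b i (chinv i u) 0 k) (chart i p).
Proof.
move=> pi; have oU := @chimg_open _ _ M i.
have [d _] := Ck_on_coord oU 0 k (bcomp_smooth b i 1).
by apply: d; exact: chimg_chart.
Qed.

Lemma differentiable_acomp i p k l : chdom i p ->
  differentiable (fun u => a i (chinv i u) k l) (chart i p).
Proof.
move=> pi; have oU := @chimg_open _ _ M i.
have [d _] := Ck_on_coord oU k l (acomp_smooth a i 1).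
by apply: d; exact: chimg_chart.
Qed.

Let dfst (f : 'rV[R]_n -> R) (x z : 'rV[R]_n) : differentiable f x ->
  differentiable (fun w : 'rV[R]_n * 'rV[R]_n => f w.1) (x, z).
Proof.
move=> df; apply: (@differentiable_comp _ _ _ _ fst f) => //.
by apply: linear_differentiable => z'; exact: cvg_fst.
Qed.

Let dsnd (x z : 'rV[R]_n) k :
  differentiable (fun w : 'rV[R]_n * 'rV[R]_n => w.2 0 k) (x, z).
Proof.
apply: (@differentiable_comp _ _ _ _ snd (fun N : 'rV[R]_n => N 0 k)).
  by apply: linear_differentiable => z'; exact: cvg_snd.
exact: differentiable_coord.
Qed.

Lemma beta_differentiable : tm_differentiable (beta b).
Proof.
move=> i p z pi; apply: differentiable_sumf => k.
apply: differentiableM; last exact: dsnd.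
by apply: (@dfst (fun u => b i (chinv i u) 0 k)); exact: differentiable_bcomp.
Qed.

Lemma alpha2_differentiable : tm_differentiable (alpha2 a).
Proof.
move=> i p z pi; apply: differentiable_sumf => k; apply: differentiable_sumf => l.
apply: differentiableM; last exact: dsnd.
apply: differentiableM; last exact: dsnd.
by apply: (@dfst (fun u => a i (chinv i u) k l)); exact: differentiable_acomp.
Qed.

Variable V : vector_field M.

(** The components of the Lie derivative of beta along V. *)
Definition lie_beta i p : 'rV[R]_n := \row_m
  (\sum_k V i p 0 k * 'D_(delta_mx 0 k) (fun u => b i (chinv i u) 0 m) (chart i p) +
   \sum_l 'D_(delta_mx 0 m) (fun u => V i (chinv i u) 0 l) (chart i p) * b i p 0 l).

Lemma complete_lift_beta i p y : chdom i p ->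
  complete_lift V (beta b) i p y = \sum_m lie_beta i p 0 m * y 0 m.
Proof.
move=> pi; rewrite /complete_lift.
have D1 k : 'D_(delta_mx 0 k) (fun u => beta b i (chinv i u) y) (chart i p) =
    \sum_m 'D_(delta_mx 0 k) (fun u => b i (chinv i u) 0 m) (chart i p) * y 0 m.
  have [] // := @is_derive_sumf _ _ _ (index_enum 'I_n)
    (fun m u => b i (chinv i u) 0 m * y 0 m)
    (fun m => 'D_(delta_mx 0 k) (fun u => b i (chinv i u) 0 m) (chart i p) * y 0 m)
    (chart i p) (delta_mx 0 k) _ => m.
  have := is_deriveMf (is_derive_diff (delta_mx 0 k)
    (differentiable_bcomp m pi)) (is_derive_cst (y 0 m) (chart i p) (delta_mx 0 k)).
  by rewrite mulr0 addr0.
have D2 l : 'D_(delta_mx 0 l) (beta b i p) y = b i p 0 l.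
  have [] // := @is_derive_sumf _ _ _ (index_enum 'I_n)
    (fun m y => b i p 0 m * y 0 m)
    (fun m => b i p 0 m * (delta_mx 0 l : 'rV[R]_n) 0 m) y (delta_mx 0 l) _ => [m|_].
    have := is_deriveMf (is_derive_cst (b i p 0 m) y (delta_mx 0 l))
      (is_derive_row_coord y (delta_mx 0 l) m).
    by rewrite mul0r add0r.
  move=> ->; rewrite (bigD1 l) //= mxE !eqxx mulr1 big1 ?addr0 // => m ml.
  by rewrite mxE (negbTE ml) andbF mulr0.
under eq_bigr do rewrite D1 mulr_sumr.
under [X in _ + X]eq_bigr do under eq_bigr do rewrite D2.
rewrite exchange_big /= -big_split; apply: eq_bigr => m _ /=.
rewrite mxE mulrDl !mulr_suml; congr (_ + _); apply: eq_bigr => k _; ring.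
Qed.

Lemma complete_lift_beta_linear i p : chdom i p ->
  linear_form (complete_lift V (beta b) i p).
Proof.
move=> pi y z s; rewrite !complete_lift_beta // mulr_sumr -big_split /=.
by apply: eq_bigr => k _; rewrite !mxE; ring.
Qed.

Lemma complete_lift_alpha2_quadratic i p : chdom i p ->
  quadratic_form (complete_lift V (alpha2 a) i p).
Proof.
move=> pi.
pose Q : 'M[R]_n := \matrix_(k, m)
  (\sum_h V i p 0 h * 'D_(delta_mx 0 h) (fun u => a i (chinv i u) k m) (chart i p) +
   \sum_l 'D_(delta_mx 0 k) (fun u => V i (chinv i u) 0 l) (chart i p) *
     (a i p l m + a i p m l)).
suff -> : complete_lift V (alpha2 a) i p =
    fun y => \sum_k \sum_l Q k l * y 0 k * y 0 l by exact: quadratic_form_mx.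
apply/funext => y; rewrite /complete_lift.
have D1 h : 'D_(delta_mx 0 h) (fun u => alpha2 a i (chinv i u) y) (chart i p) =
    \sum_k \sum_m 'D_(delta_mx 0 h) (fun u => a i (chinv i u) k m) (chart i p) *
      y 0 k * y 0 m.
  have [] // := @is_derive_sumf _ _ _ (index_enum 'I_n)
    (fun k u => \sum_m a i (chinv i u) k m * y 0 k * y 0 m)
    (fun k => \sum_m 'D_(delta_mx 0 h) (fun u => a i (chinv i u) k m) (chart i p) *
      y 0 k * y 0 m) (chart i p) (delta_mx 0 h) _ => k.
  apply: is_derive_sumf => m.
  have := is_deriveMf (is_deriveMf (is_derive_diff (delta_mx 0 h)
    (differentiable_acomp k m pi))
    (is_derive_cst (y 0 k) (chart i p) (delta_mx 0 h)))
    (is_derive_cst (y 0 m) (chart i p) (delta_mx 0 h)).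
  by rewrite !mulr0 !addr0.
have D2 l : 'D_(delta_mx 0 l) (alpha2 a i p) y =
    \sum_m (a i p l m + a i p m l) * y 0 m.
  have [] // := @is_derive_sumf _ _ _ (index_enum 'I_n)
    (fun k y => \sum_m a i p k m * y 0 k * y 0 m)
    (fun k => \sum_m (a i p k m * (delta_mx 0 l : 'rV[R]_n) 0 k * y 0 m +
      a i p k m * y 0 k * (delta_mx 0 l : 'rV[R]_n) 0 m)) y (delta_mx 0 l) _ => [k|_].
    apply: is_derive_sumf => m.
    have := is_deriveMf (is_deriveMf (is_derive_cst (a i p k m) y (delta_mx 0 l))
      (is_derive_row_coord y (delta_mx 0 l) k)) (is_derive_row_coord y (delta_mx 0 l) m).
    by rewrite mul0r add0r.
  move=> ->; under eq_bigr do rewrite big_split /=.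
  rewrite big_split /=.
  under [RHS]eq_bigr do rewrite mulrDl.
  rewrite [RHS]big_split /=; congr (_ + _).
    rewrite (bigD1 l) //= [X in _ + X]big1 ?addr0.
      by apply: eq_bigr => m _; rewrite mxE !eqxx mulr1.
    by move=> k kl; rewrite big1 // => m _; rewrite mxE (negbTE kl) andbF mulr0 mul0r.
  apply: eq_bigr => k _; rewrite (bigD1 l) //= mxE !eqxx mulr1 big1 ?addr0 // => m ml.
  by rewrite mxE (negbTE ml) andbF mulr0.
under eq_bigr do rewrite D1 mulr_sumr.
under [X in _ + X]eq_bigr do under eq_bigr do rewrite D2.
rewrite exchange_big /= -big_split; apply: eq_bigr => k _ /=.
under eq_bigr do rewrite mulr_sumr.
under [X in _ + X]eq_bigr do rewrite mulr_sumr.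
rewrite exchange_big [X in _ + X]exchange_big /= -big_split; apply: eq_bigr => m _ /=.
rewrite mxE !mulrDl !mulr_suml; congr (_ + _); apply: eq_bigr => h _; ring.
Qed.

Lemma beta_self_gt0 i p : b i p <> 0 -> 0 < beta b i p (b i p).
Proof.
move=> b0; rewrite lt_neqAle sumr_ge0 ?andbT; last first.
  by move=> k _; rewrite -expr2 sqr_ge0.
apply/eqP => /esym/eqP; rewrite psumr_eq0; last first.
  by move=> k _; rewrite -expr2 sqr_ge0.
move=> /allP H; apply: b0; apply/rowP => k; rewrite mxE.
by have := H k; rewrite mem_index_enum => /(_ isT) /=; rewrite mulf_eq0 orbb => /eqP.
Qed.

(** The factor is V^c beta / beta evaluated at the components of beta itself, a
    vector on which beta does not vanish.  This formula shows smoothness in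
    each chart; chart independence follows from that of V^c beta, which is
    where the flow comes in. *)
Lemma lie_beta_factor_smooth (phi : flow V) :
  (forall i p, chdom i p -> b i p <> 0) ->
  (forall i p, chdom i p -> exists t, forall y,
    complete_lift V (beta b) i p y = t * beta b i p y) ->
  exists tau : M -> R, smooth_fun tau /\ forall i p y, chdom i p ->
    complete_lift V (beta b) i p y = tau p * beta b i p y.
Proof.
move=> b0 prop.
pose T i p := complete_lift V (beta b) i p (b i p) / beta b i p (b i p).
have TP i p y : chdom i p -> complete_lift V (beta b) i p y = T i p * beta b i p y.
  move=> pi; have [t ht] := prop i p pi.
  rewrite /T !ht mulfK // gt_eqF // beta_self_gt0 //; exact: b0.
have Tij i j p : chdom i p -> chdom j p -> T i p = T j p.
  move=> pi pj; have := beta_self_gt0 (b0 i p pi); set y := b i p => by0.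
  have := complete_lift_change phi y beta_differentiable beta_invariant pi pj.
  rewrite !TP // beta_invariant // => /mulIf -> //; exact: lt0r_neq0.
pose tau p := T (projT1 (cid (chdom_cover p))) p.
have tauE i p : chdom i p -> tau p = T i p.
  by rewrite /tau; case: cid => j /= pj pi; exact: Tij.
exists tau; split; last by move=> i p y pi; rewrite (tauE _ _ pi) TP.
move=> i k; have oU := @chimg_open _ _ M i.
have cb m k' : Ck_on k' (chimg i) (fun u => b i (chinv i u) 0 m).
  exact: (Ck_on_coord oU 0 m (bcomp_smooth b i k')).
have cV m k' : Ck_on k' (chimg i) (fun u => V i (chinv i u) 0 m).
  exact: (Ck_on_coord oU 0 m (vcomp_smooth V i k')).
have cDb m v : Ck_on k (chimg i) ('D_v (fun u => b i (chinv i u) 0 m)).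
  by have [_] := cb m k.+1; exact.
have cDV m v : Ck_on k (chimg i) ('D_v (fun u => V i (chinv i u) 0 m)).
  by have [_] := cV m k.+1; exact.
have cbb : Ck_on k (chimg i) (fun u => beta b i (chinv i u) (b i (chinv i u))).
  by apply: Ck_on_sum => // m; apply: Ck_onM.
have cB : Ck_on k (chimg i) (fun u => \sum_m
    (\sum_k V i (chinv i u) 0 k * 'D_(delta_mx 0 k) (fun u => b i (chinv i u) 0 m) u +
     \sum_l 'D_(delta_mx 0 m) (fun u => V i (chinv i u) 0 l) u * b i (chinv i u) 0 l)
     * b i (chinv i u) 0 m).
  apply: Ck_on_sum => // m; apply: Ck_onM => //; apply: Ck_onD => //.
    by apply: Ck_on_sum => // l; apply: Ck_onM.
  by apply: Ck_on_sum => // l; apply: Ck_onM.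
have bb0 u : chimg i u -> beta b i (chinv i u) (b i (chinv i u)) != 0.
  move=> ui; apply: lt0r_neq0; apply: beta_self_gt0; apply: b0; exact: chdom_chinv.
apply: (Ck_on_eq oU) (Ck_onM oU cB (Ck_onV oU bb0 cbb)) => u ui.
have pi := chdom_chinv ui.
rewrite /= (tauE _ _ pi) /T complete_lift_beta //; congr (_ * _).
by apply: eq_bigr => m _; rewrite mxE chinvK.
Qed.

End Lifts.

(** * The inequality beta^2 <= alpha^2 *)

Section CauchySchwarz.
Context {R : realType} {n : nat} {M : manifold R n}.
Variables (a : riemannian_metric M) (b : one_form M).

(** The vector metrically dual to beta, at which beta attains its norm. *)
Definition dual_vector i p : 'rV[R]_n := b i p *m invmx (a i p).

Lemma alpha2E i p (y : 'rV[R]_n) : alpha2 a i p y = (y *m a i p *m y^T) 0 0.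
Proof.
rewrite /alpha2 mxE exchange_big /=; apply: eq_bigr => l _.
rewrite mxE mulr_suml; apply: eq_bigr => k _; rewrite mxE; ring.
Qed.

Lemma betaE i p (y : 'rV[R]_n) : beta b i p y = (b i p *m y^T) 0 0.
Proof. by rewrite /beta mxE; apply: eq_bigr => k _; rewrite mxE. Qed.

Lemma acomp_unit i p : chdom i p -> a i p \in unitmx.
Proof.
move=> pi; rewrite -row_free_unit -kermx_eq0; apply/eqP/row_matrixP => k.
rewrite row0; apply/eqP/negPn/negP => y0.
have := acomp_pos a pi y0; rewrite -[X in 0 < X]/(alpha2 a i p _) alpha2E.
by rewrite -row_mul mulmx_ker row0 mul0mx mxE ltxx.
Qed.

Lemma dual_vectorK i p : chdom i p -> dual_vector i p *m a i p = b i p.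
Proof. by move=> pi; rewrite /dual_vector mulmxKV // acomp_unit. Qed.

Lemma beta_dual_vector i p : norm_beta a b i p = 1 ->
  beta b i p (dual_vector i p) = 1.
Proof.
rewrite /norm_beta; set S := \sum_k _ => S1.
have -> : beta b i p (dual_vector i p) = S.
  rewrite /S exchange_big /=; apply: eq_bigr => l _.
  rewrite mxE mulr_sumr; apply: eq_bigr => k _; ring.
have S0 : 0 <= S.
  by rewrite leNgt; apply/negP => /ltW /ler0_sqrtr S0; move: S1; rewrite S0; lra.
by rewrite -(sqr_sqrtr S0) S1 expr1n.
Qed.

Lemma alpha2_dual_vector i p : chdom i p -> norm_beta a b i p = 1 ->
  alpha2 a i p (dual_vector i p) = 1.
Proof. by move=> pi nb; rewrite alpha2E dual_vectorK // -betaE beta_dual_vector. Qed.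

(** Cauchy-Schwarz: alpha^2 is nonnegative at y - beta(y) w, with w the dual
    vector. *)
Lemma beta_sqr_le i p y : chdom i p -> norm_beta a b i p = 1 ->
  beta b i p y ^+ 2 <= alpha2 a i p y.
Proof.
move=> pi nb; set w := dual_vector i p; set s := beta b i p y.
have a0 z : 0 <= alpha2 a i p z.
  have [->|z0] := eqVneq z 0; last exact/ltW/acomp_pos.
  by rewrite alpha2E mul0mx mul0mx mxE.
have C1 : (w *m a i p *m y^T) 0 0 = s by rewrite dual_vectorK // -betaE.
have C2 : (y *m a i p *m w^T) 0 0 = s.
  have tr (X : 'M[R]_1) : X 0 0 = X^T 0 0 by rewrite mxE.
  by rewrite tr (trmx_mul _ w^T) (trmx_mul y) trmxK acomp_sym // mulmxA C1.
have C3 := alpha2_dual_vector pi nb; rewrite alpha2E -/w in C3.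
have := a0 (y - s *: w); rewrite !alpha2E.
have -> : (y - s *: w)^T = y^T - s *: w^T by rewrite linearB linearZ.
rewrite !mulmxBl !mulmxBr.
rewrite -!scalemxAl -!scalemxAr.
move: (y *m _ *m y^T) (w *m _ *m y^T) (y *m _ *m w^T) (w *m _ *m w^T) C1 C2 C3.
move=> X1 X2 X3 X4 C1 C2 C3; rewrite !mxE C1 C2 C3; lra.
Qed.

End CauchySchwarz.

(** * Conformal fields of the two metrics *)

Section Conformal.
Context {R : realType} {n : nat} {M : manifold R n}.
Variables (a : riemannian_metric M) (b : one_form M).
Variables (V : vector_field M) (phi : flow V).
Implicit Types (i j : chidx M) (p : M) (y : 'rV[R]_n).
Local Notation fmap := Defs.fmap.

(** Taking logarithms makes the two metrics amenable to one argument: both are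
    exponentials of explicit functions of beta and alpha^2. *)
Definition has_log (F : tmfun M) (L : R -> R -> R) := forall i p y,
  chdom i p -> 0 < beta b i p y ->
  F i p y = expR (L (beta b i p y) (alpha2 a i p y)).

Lemma kropina_log m :
  has_log (kropina a b m) (fun u v => m * ln u + (1 - m) / 2 * ln v).
Proof.
move=> i p y pi by0; have ay0 := alpha2_gt0 a pi by0.
rewrite /kropina /alpha -(powR12_sqrt (ltW ay0)) -powRrM /powR.
rewrite (gt_eqF by0) (gt_eqF ay0).
by move: (ln _) (ln _) => u v; rewrite -expRD; apply: (f_equal (@expR R)); field.
Qed.

Lemma exp_metric_log e : has_log (exp_metric a b e) (fun u v => ln u + e * (v / u ^+ 2)).
Proof. by move=> i p y pi by0; rewrite /exp_metric expRD lnK. Qed.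

Lemma is_derive_push_tm0 (f : tmfun M) i p y : tm_differentiable f -> chdom i p ->
  is_derive (0 : R) 1 (fun s => f i (fmap phi s p) (push phi s i i p y))
    (complete_lift V f i p y).
Proof.
move=> df pi; have pi0 : chdom i (fmap phi 0 p) by rewrite fmap0.
by have := is_derive_push_tm y df pi (fdom0 phi p) pi0; rewrite push0 fmap0 tchange_id.
Qed.

(** The logarithmic form of conformality, differentiated at t = 0. *)
Lemma conformal_log_derive (F : tmfun M) L (c : M -> R) i p y d :
  has_log F L -> conformal phi (beta_cone b) F c ->
  chdom i p -> 0 < beta b i p y ->
  is_derive (0 : R) 1 (fun s => L (beta b i (fmap phi s p) (push phi s i i p y))
    (alpha2 a i (fmap phi s p) (push phi s i i p y))) d ->
  d = 2 * c p.
Proof.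
move=> hL [sigma [Hs Ds]] pi by0 [_ <-].
pose L0 := L (beta b i p y) (alpha2 a i p y).
have D : is_derive (0 : R) 1 (fun s => 2 * sigma s p + L0) (2 * c p).
  apply: is_derive_eq (is_deriveDf (is_deriveZf 2 (Ds p)) (is_derive_cst L0 _ _)) _.
  by rewrite addr0.
have [_ <-] := D; apply: near_eq_derive.
have pi0 : chdom i (fmap phi 0 p) by rewrite fmap0.
apply: filterS (near_flow (fdom0 phi p) pi0) => s [sd si].
have [pos eqF] := Hs _ _ _ _ y sd pi si.
have bs := pos.2 by0; have := eqF by0.
by rewrite (hL _ _ _ si bs) (hL _ _ _ pi by0) -expRD => /expR_inj.
Qed.

(** The third hypothesis, that beta is multiplied by a positive factor along
    the flow, is what makes the flow preserve the cone beta > 0. *)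
Lemma conformal_of_log (F : tmfun M) L (c : M -> R) (K : M -> R -> R) :
  has_log F L -> (forall p, is_derive (0 : R) 1 (K p) (c p)) ->
  (forall i p y t, chdom i p -> fdom phi (t, p) ->
    exists2 r, 0 < r & tm_along phi (beta b) i p y t = r * beta b i p y) ->
  (forall i p y t, chdom i p -> fdom phi (t, p) -> 0 < beta b i p y ->
    L (tm_along phi (beta b) i p y t) (tm_along phi (alpha2 a) i p y t) =
    2 * K p t + L (beta b i p y) (alpha2 a i p y)) ->
  conformal phi (beta_cone b) F c.
Proof.
move=> hL DK Hr HL; exists (fun t p => K p t); split=> // t p i j y pd pi pj.
have [r r0] := Hr i p y t pi pd.
rewrite (tm_alongE y (beta_invariant b) pi pd pj) /beta_cone /= => Er.
rewrite Er pmulr_rgt0 //; split=> // by0.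
rewrite (hL _ _ _ pi by0) -expRD -(HL i p y t pi pd by0).
rewrite (tm_alongE y (beta_invariant b) pi pd pj).
rewrite (tm_alongE y (alpha2_invariant a) pi pd pj).
by rewrite (hL _ _ _ pj) // Er mulr_gt0.
Qed.

Lemma primitive_along (k : M -> R) : smooth_fun k ->
  exists K : M -> R -> R, forall p, K p 0 = 0 /\
    forall t, fdom phi (t, p) -> is_derive t 1 (K p) (k (fmap phi t p)).
Proof.
move=> hk.
have H p : exists K : R -> R, K 0 = 0 /\
    forall t, fdom phi (t, p) -> is_derive t 1 K (k (fmap phi t p)).
  apply: (@primitive _ [set t | fdom phi (t, p)] (fun t => k (fmap phi t p))).
  - rewrite openE => t /= pd; have [j pj] := chdom_cover (fmap phi t p).
    by apply: filterS (near_flow pd pj) => s [].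
  - exact: fdom_interval.
  - exact: fdom0.
  - by move=> t pd; exact: continuous_along_flow.
by exists (fun p => projT1 (cid (H p))) => p; case: cid.
Qed.

Lemma along_ode (f : tmfun M) (k : M -> R) (K : R -> R) i p y :
  tm_differentiable f -> tm_invariant f -> chdom i p -> K 0 = 0 ->
  (forall t, fdom phi (t, p) -> is_derive t 1 K (k (fmap phi t p))) ->
  (forall j q z, chdom j q -> complete_lift V f j q z = k q * f j q z) ->
  forall t, fdom phi (t, p) -> tm_along phi f i p y t = expR (K t) * f i p y.
Proof.
move=> df fi pi K0 DK Lf t pd; rewrite -(tm_along0 phi y fi pi).
apply: (@linear_ode _ [set t | fdom phi (t, p)] _ (fun t => k (fmap phi t p)) K) => //=.
- exact: fdom_interval.
- exact: fdom0.
- move=> s sd; have [j sj] := chdom_cover (fmap phi s p).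
  rewrite (tm_alongE y fi pi sd sj) -Lf //.
  exact: is_derive_tm_along.
Qed.

(** The algebraic core of both cases: [q] will be alpha^2, which has no zeros
    on the kernel of beta except 0, so [l] vanishes on that kernel. *)
Lemma proportional_to_beta (q r : 'rV[R]_n -> R) l i p :
  chdom i p -> b i p <> 0 -> quadratic_form q -> quadratic_form r ->
  linear_form l ->
  (forall y, 0 < beta b i p y -> q y * l y + r y * beta b i p y = 0) ->
  (forall y, y != 0 -> q y != 0) ->
  exists t, forall y, l y = t * beta b i p y.
Proof.
move=> pi b0 hq hr hl H q0.
have by0 := beta_self_gt0 b0.
have hb := beta_linear b i p.
exists (l (b i p) / beta b i p (b i p)).
apply: linear_form_proportional => //; first exact: lt0r_neq0.
move=> z bz; have := cone_kernel hq hr hl hb by0 H bz.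
have [->|z0] := eqVneq z 0; first by have := linear_formZ 0 0 hl; rewrite scale0r mul0r.
by move=> /eqP; rewrite mulf_eq0 (negbTE (q0 _ z0)) /= => /eqP.
Qed.

Lemma alpha2_neq0 i p y : chdom i p -> y != 0 -> alpha2 a i p y != 0.
Proof. by move=> pi y0; rewrite lt0r_neq0 //; exact: acomp_pos. Qed.

Lemma kropina_conformal_forward (m : R) (c : M -> R) : m <> 0 -> m <> 1 ->
  (forall i p, chdom i p -> norm_beta a b i p = 1) ->
  conformal phi (beta_cone b) (kropina a b m) c ->
  forall i p y, chdom i p ->
    complete_lift V (alpha2 a) i p y = 4 * c p * alpha2 a i p y /\
    complete_lift V (beta b) i p y = 2 * c p * beta b i p y.
Proof.
move=> m0 m1 nb conf i p y pi.
set A := complete_lift V (alpha2 a) i p; set B := complete_lift V (beta b) i p.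
have hA : quadratic_form A by exact: complete_lift_alpha2_quadratic.
have hB : linear_form B by exact: complete_lift_beta_linear.
have hb := beta_linear b i p.
have m1' : 1 - m != 0 by apply/eqP; lra.
pose w := dual_vector a b i p.
have bw : beta b i p w = 1 by exact/beta_dual_vector/nb.
have aw : alpha2 a i p w = 1 by apply: alpha2_dual_vector => //; exact: nb.
have b0 : b i p <> 0.
  by move=> b0; move: bw; rewrite /beta b0 big1 ?(oner_eq0) => [|k _]; [lra|rewrite mxE mul0r].
(* The derivative of m ln beta + (1 - m) / 2 ln alpha^2 along the flow is 2 c;
   this is that equation cleared of its denominators. *)
have id1 z : 0 < beta b i p z ->
    alpha2 a i p z * (2 * m * B z + - (4 * c p) * beta b i p z) +
    (1 - m) * A z * beta b i p z = 0.
  move=> bz; have az := alpha2_gt0 a pi bz.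
  have DB := is_derive_push_tm0 z (beta_differentiable b) pi.
  have DA := is_derive_push_tm0 z (alpha2_differentiable a) pi.
  have bz' : 0 < beta b i (fmap phi 0 p) (push phi 0 i i p z).
    by rewrite push0 fmap0 tchange_id.
  have az' : 0 < alpha2 a i (fmap phi 0 p) (push phi 0 i i p z).
    by rewrite push0 fmap0 tchange_id.
  have := conformal_log_derive (@kropina_log m) conf pi bz
    (is_deriveDf (is_deriveZf m (is_derive_lnf bz' DB))
      (is_deriveZf ((1 - m) / 2) (is_derive_lnf az' DA))).
  rewrite push0 fmap0 tchange_id // -/A -/B => E.
  have -> : c p = (m * ((beta b i p z)^-1 * B z) +
    (1 - m) / 2 * ((alpha2 a i p z)^-1 * A z)) / 2 by rewrite E; field.
  by field; rewrite !gt_eqF.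
have [t Bt] : exists t, forall y, B y = t * beta b i p y.
  have hl : linear_form (fun z => 2 * m * B z + - (4 * c p) * beta b i p z).
    by move=> z1 z2 s; rewrite hB hb; ring.
  have hr : quadratic_form (fun z => (1 - m) * A z).
    move=> z1 z2; have [d hd] := hA z1 z2; exists ((1 - m) * d) => s.
    by rewrite hd; ring.
  have [t0 Ht] := proportional_to_beta pi b0 (alpha2_quadratic a i p) hr hl id1
    (fun y => alpha2_neq0 pi).
  exists ((t0 + 4 * c p) / (2 * m)) => z.
  have -> : B z = (t0 * beta b i p z + 4 * c p * beta b i p z) / (2 * m).
    by rewrite -Ht; field; apply/eqP.
  by field; apply/eqP.
(* With B = t beta, the identity divided by beta reads
   (1 - m) A = (4 c - 2 m t) alpha^2. *)
pose mu := (4 * c p - 2 * m * t) / (1 - m).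
have At z : A z = mu * alpha2 a i p z.
  apply/eqP; rewrite -subr_eq0 -mulNr; apply/eqP.
  apply: (quadratic_form_cone_eq0 (q := fun z => A z + - mu * alpha2 a i p z) _ hb
    (beta_self_gt0 b0)).
    exact: quadratic_formD_scaled hA (alpha2_quadratic a i p).
  move=> x bx; have := id1 x bx; rewrite Bt.
  have -> : alpha2 a i p x * (2 * m * (t * beta b i p x) + - (4 * c p) * beta b i p x) +
    (1 - m) * A x * beta b i p x =
    (1 - m) * beta b i p x * (A x + - mu * alpha2 a i p x) by rewrite /mu; field.
  by move=> /eqP; rewrite !mulf_eq0 (negbTE m1') gt_eqF //= => /eqP.
(* The norm condition enters here: alpha_s^2 - beta_s^2 at the dual vector is
   nonnegative and vanishes for s = 0, so its derivative at 0 is zero. *)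
have crit : mu = 2 * t.
  pose f s := alpha2 a i (fmap phi s p) (push phi s i i p w) -
    beta b i (fmap phi s p) (push phi s i i p w) * beta b i (fmap phi s p) (push phi s i i p w).
  pose df s := complete_lift V (alpha2 a) i (fmap phi s p) (push phi s i i p w) -
    (complete_lift V (beta b) i (fmap phi s p) (push phi s i i p w) *
       beta b i (fmap phi s p) (push phi s i i p w) +
     beta b i (fmap phi s p) (push phi s i i p w) *
       complete_lift V (beta b) i (fmap phi s p) (push phi s i i p w)).
  have : df 0 = 0.
    apply: (derive_at_local_min (f := f)).
    have pi0 : chdom i (fmap phi 0 p) by rewrite fmap0.
    apply: filterS (near_flow (fdom0 phi p) pi0) => s [sd si]; split.
      apply: is_deriveBf; first exact: is_derive_push_tm (alpha2_differentiable a) pi sd si.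
      by apply: is_deriveMf; exact: is_derive_push_tm (beta_differentiable b) pi sd si.
    rewrite {1}/f push0 fmap0 tchange_id // aw bw mulr1 subrr /f subr_ge0 -expr2.
    by apply: beta_sqr_le => //; exact: nb.
  rewrite /df push0 fmap0 tchange_id // -/A -/B At Bt aw bw; lra.
have tc : t = 2 * c p.
  have : mu * (1 - m) = 4 * c p - 2 * m * t by rewrite /mu divfK.
  by rewrite crit; lra.
by rewrite At Bt crit tc; split=> //; ring.
Qed.

Lemma kropina_conformal_backward (m : R) (c : M -> R) : smooth_fun c ->
  (forall i p y, chdom i p ->
    complete_lift V (alpha2 a) i p y = 4 * c p * alpha2 a i p y /\
    complete_lift V (beta b) i p y = 2 * c p * beta b i p y) ->
  conformal phi (beta_cone b) (kropina a b m) c.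
Proof.
move=> hc H; have [K HK] := primitive_along hc.
have DK p (k t : R) : fdom phi (t, p) ->
    is_derive t 1 (fun s => k * K p s) (k * c (fmap phi t p)).
  by move=> pd; apply: is_deriveZf; exact: (HK p).2.
have Eb i p y t : chdom i p -> fdom phi (t, p) ->
    tm_along phi (beta b) i p y t = expR (2 * K p t) * beta b i p y.
  move=> pi; apply: (along_ode (k := fun q => 2 * c q) (K := fun s => 2 * K p s)) => //.
  - exact: beta_differentiable.
  - exact: beta_invariant.
  - by rewrite (HK p).1 mulr0.
  - by move=> j q z qj; exact: (H j q z qj).2.
have Ea i p y t : chdom i p -> fdom phi (t, p) ->
    tm_along phi (alpha2 a) i p y t = expR (4 * K p t) * alpha2 a i p y.
  move=> pi; apply: (along_ode (k := fun q => 4 * c q) (K := fun s => 4 * K p s)) => //.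
  - exact: alpha2_differentiable.
  - exact: alpha2_invariant.
  - by rewrite (HK p).1 mulr0.
  - by move=> j q z qj; exact: (H j q z qj).1.
apply: (conformal_of_log (K := K) (@kropina_log m)).
- by move=> p; have := (HK p).2 0 (fdom0 phi p); rewrite fmap0.
- by move=> i p y t pi pd; exists (expR (2 * K p t)); [exact: expR_gt0|exact: Eb].
- move=> i p y t pi pd by0; rewrite Eb // Ea //.
  have ay0 := alpha2_gt0 a pi by0.
  by rewrite !lnM ?posrE ?expR_gt0 // !expRK; field.
Qed.

Lemma exp_metric_conformal_forward (e : R) (c : M -> R) : e = 1 \/ e = -1 ->
  (forall i p, chdom i p -> b i p <> 0) ->
  conformal phi (beta_cone b) (exp_metric a b e) c ->
  exists tau : M -> R, smooth_fun tau /\ forall i p y, chdom i p ->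
    complete_lift V (alpha2 a) i p y =
      2 * tau p * alpha2 a i p y + e * (2 * c p - tau p) * beta b i p y ^+ 2 /\
    complete_lift V (beta b) i p y = tau p * beta b i p y.
Proof.
move=> he b0 conf.
have e2 : e * e = 1 by case: he => ->; rewrite ?mulr1 ?mulrNN ?mulr1.
have e0 : e != 0 by case: he => ->; rewrite ?oppr_eq0 oner_eq0.
(* The same for ln beta + e alpha^2 / beta^2.  The identity is grouped so that
   alpha^2 times a linear form is a multiple of beta. *)
have id1 i p z : chdom i p -> 0 < beta b i p z ->
    alpha2 a i p z * (- (2 * e) * complete_lift V (beta b) i p z) +
    (e * complete_lift V (alpha2 a) i p z + complete_lift V (beta b) i p z * beta b i p z
     - 2 * c p * (beta b i p z * beta b i p z)) * beta b i p z = 0.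
  move=> pi bz.
  have DB := is_derive_push_tm0 z (beta_differentiable b) pi.
  have DA := is_derive_push_tm0 z (alpha2_differentiable a) pi.
  have bz' : 0 < beta b i (fmap phi 0 p) (push phi 0 i i p z).
    by rewrite push0 fmap0 tchange_id.
  have b2 : beta b i (fmap phi 0 p) (push phi 0 i i p z) *
      beta b i (fmap phi 0 p) (push phi 0 i i p z) != 0.
    by rewrite mulf_neq0 // gt_eqF.
  have D2 := is_derive_inv (f := fun s => beta b i (fmap phi s p) (push phi s i i p z) *
    beta b i (fmap phi s p) (push phi s i i p z)) b2 (is_deriveMf DB DB).
  have := conformal_log_derive (@exp_metric_log e) conf pi bz
    (is_deriveDf (is_derive_lnf bz' DB) (is_deriveZf e (is_deriveMf DA D2))).
  rewrite push0 fmap0 tchange_id // => E.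
  rewrite -E; field; exact: lt0r_neq0.
have [tau [htau Ht]] : exists tau : M -> R, smooth_fun tau /\
    forall i p y, chdom i p -> complete_lift V (beta b) i p y = tau p * beta b i p y.
  apply: (lie_beta_factor_smooth phi b0) => i p pi.
  set A := complete_lift V (alpha2 a) i p; set B := complete_lift V (beta b) i p.
  have hA : quadratic_form A by exact: complete_lift_alpha2_quadratic.
  have hB : linear_form B by exact: complete_lift_beta_linear.
  have hb := beta_linear b i p.
  have hl : linear_form (fun z => - (2 * e) * B z) by move=> x z s; rewrite hB; ring.
  have hr : quadratic_form (fun z => e * A z + B z * beta b i p z -
      2 * c p * (beta b i p z * beta b i p z)).
    move=> x z; have [d hd] := hA x z.
    have [d1 hd1] := quadratic_formM hB hb x z.
    have [d2 hd2] := quadratic_formM hb hb x z.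
    by exists (e * d + d1 - 2 * c p * d2) => s; rewrite hd hd1 hd2; ring.
  have [t Et] := proportional_to_beta pi (b0 _ _ pi) (alpha2_quadratic a i p) hr hl
    (fun z => @id1 i p z pi) (fun y => alpha2_neq0 pi).
  exists (t / (- (2 * e))) => z.
  have -> : B z = (t * beta b i p z) / (- (2 * e)) by rewrite -Et; field.
  by field.
exists tau; split=> // i p y pi; split; last exact: Ht.
have hA : quadratic_form (complete_lift V (alpha2 a) i p).
  exact: complete_lift_alpha2_quadratic.
have hb := beta_linear b i p.
pose q z := complete_lift V (alpha2 a) i p z + - (2 * tau p) * alpha2 a i p z +
  - (e * (2 * c p - tau p)) * (beta b i p z * beta b i p z).
suff : q y = 0.
  by rewrite /q expr2 => H; apply/eqP; rewrite -subr_eq0 -H; apply/eqP; ring.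
apply: (quadratic_form_cone_eq0 _ hb (beta_self_gt0 (b0 _ _ pi))).
  apply: quadratic_formD_scaled; last exact: quadratic_formM.
  exact: quadratic_formD_scaled hA (alpha2_quadratic a i p).
move=> x bx; have := id1 i p x pi bx; rewrite Ht //.
have -> : alpha2 a i p x * (- (2 * e) * (tau p * beta b i p x)) +
    (e * complete_lift V (alpha2 a) i p x + tau p * beta b i p x * beta b i p x -
     2 * c p * (beta b i p x * beta b i p x)) * beta b i p x =
    e * beta b i p x * q x.
  have -> : e * beta b i p x * q x = beta b i p x * (e * complete_lift V (alpha2 a) i p x
    - 2 * e * tau p * alpha2 a i p x - e * e * (2 * c p - tau p) *
    (beta b i p x * beta b i p x)) by rewrite /q; ring.
  by rewrite e2; ring.
by move=> /eqP; rewrite !mulf_eq0 (negbTE e0) gt_eqF //= => /eqP.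
Qed.

(** The factor of alpha^2 in its own equation is 2 tau and the inhomogeneous
    term is e (2 c - tau) beta^2; integrating, alpha^2 / beta^2 changes by
    e (2 S - T), where S and T are primitives of c and tau, and so
    e alpha^2 / beta^2 + ln beta changes by 2 S, as e^2 = 1. *)
Lemma exp_metric_conformal_backward (e : R) (c tau : M -> R) : e = 1 \/ e = -1 ->
  smooth_fun c -> smooth_fun tau ->
  (forall i p y, chdom i p ->
    complete_lift V (alpha2 a) i p y =
      2 * tau p * alpha2 a i p y + e * (2 * c p - tau p) * beta b i p y ^+ 2 /\
    complete_lift V (beta b) i p y = tau p * beta b i p y) ->
  conformal phi (beta_cone b) (exp_metric a b e) c.
Proof.
move=> he hc ht H.
have e2 : e * e = 1 by case: he => ->; rewrite ?mulr1 ?mulrNN ?mulr1.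
have [S HS] := primitive_along hc; have [T HT] := primitive_along ht.
have Eb i p y t : chdom i p -> fdom phi (t, p) ->
    tm_along phi (beta b) i p y t = expR (T p t) * beta b i p y.
  move=> pi; apply: (along_ode (k := tau)) => //.
  - exact: beta_differentiable.
  - exact: beta_invariant.
  - exact: (HT p).1.
  - exact: (HT p).2.
  - by move=> j q z qj; exact: (H j q z qj).2.
have Ea i p y t : chdom i p -> fdom phi (t, p) ->
    tm_along phi (alpha2 a) i p y t = expR (T p t) ^+ 2 *
      (alpha2 a i p y + e * (2 * S p t - T p t) * beta b i p y ^+ 2).
  move=> pi pd.
(* With beta_s = exp (T) beta_0, variation of constants shows that the
   combination [f] is conserved along the orbit. *)
  pose f s := expR (- (2) * T p s) * tm_along phi (alpha2 a) i p y s -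
    e * beta b i p y ^+ 2 * (2 * S p s - T p s).
  have Df s : fdom phi (s, p) -> is_derive s 1 f 0.
    move=> sd; have [j sj] := chdom_cover (fmap phi s p).
    have Dal := is_derive_tm_along y (alpha2_differentiable a)
      (alpha2_invariant a) pi sd sj.
    have DT := (HT p).2 s sd; have DS := (HS p).2 s sd.
    apply: is_derive_eq (is_deriveBf
      (is_deriveMf (is_derive_expRf (is_deriveZf (- (2)) DT)) Dal)
      (is_deriveZf (e * beta b i p y ^+ 2) (is_deriveBf (is_deriveZf 2 DS) DT))) _.
    rewrite (H _ _ _ sj).1 -(tm_alongE y (alpha2_invariant a) pi sd sj).
    rewrite -(tm_alongE y (beta_invariant b) pi sd sj) Eb //.
    rewrite mulNr expRN -[2 * T p s]/(2%:R * T p s) expRM_natl.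
    by field; rewrite gt_eqF // expR_gt0.
  have : f t = f 0.
    exact: (derive0_cst (fdom_interval (f := phi) (p := p)) Df pd (fdom0 _ _)).
  rewrite /f (HS p).1 (HT p).1 !mulr0 subrr mulr0 expR0 mul1r subr0.
  rewrite (tm_along0 phi y (alpha2_invariant a) pi).
  rewrite mulNr expRN -[2 * T p t]/(2%:R * T p t) expRM_natl => <-.
  by field; rewrite gt_eqF // expR_gt0.
apply: (conformal_of_log (K := S) (@exp_metric_log e)).
- by move=> p; have := (HS p).2 0 (fdom0 phi p); rewrite fmap0.
- by move=> i p y t pi pd; exists (expR (T p t)); [exact: expR_gt0|exact: Eb].
- move=> i p y t pi pd by0; rewrite Eb // Ea // lnM ?posrE ?expR_gt0 // expRK.
  have -> : expR (T p t) ^+ 2 *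
      (alpha2 a i p y + e * (2 * S p t - T p t) * beta b i p y ^+ 2) /
      (expR (T p t) * beta b i p y) ^+ 2 =
      alpha2 a i p y / beta b i p y ^+ 2 + e * (2 * S p t - T p t).
    by field; rewrite !gt_eqF // expR_gt0.
  by rewrite (mulrDr e) (mulrA e e) e2; ring.
Qed.

End Conformal.

Theorem theorem1p2 (R : realType) (n : nat) (M : manifold R n)
  (a : riemannian_metric M) (b : one_form M)
  (V : vector_field M) (phi : flow V) (c : M -> R) (hc : smooth_fun c) :
  (forall m : R, m <> 0 -> m <> 1 ->
    (forall (i : chidx M) (p : M), chdom i p -> norm_beta a b i p = 1) ->
    (conformal phi (beta_cone b) (kropina a b m) c <->
     forall (i : chidx M) (p : M) (y : 'rV[R]_n), chdom i p ->
       complete_lift V (alpha2 a) i p y = 4 * c p * alpha2 a i p y /\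
       complete_lift V (beta b) i p y = 2 * c p * beta b i p y)) /\
  (forall e : R, e = 1 \/ e = -1 ->
    (forall (i : chidx M) (p : M), chdom i p -> b i p <> 0) ->
    (conformal phi (beta_cone b) (exp_metric a b e) c <->
     exists tau : M -> R, smooth_fun tau /\
     forall (i : chidx M) (p : M) (y : 'rV[R]_n), chdom i p ->
       complete_lift V (alpha2 a) i p y =
         2 * tau p * alpha2 a i p y + e * (2 * c p - tau p) * beta b i p y ^+ 2 /\
       complete_lift V (beta b) i p y = tau p * beta b i p y)).
Proof.
split=> [m m0 m1 nb|e he b0]; split.
- exact: kropina_conformal_forward.
- exact: kropina_conformal_backward.
- exact: exp_metric_conformal_forward.
- by move=> [tau [ht H]]; exact: exp_metric_conformal_backward he hc ht H.
Qed.
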